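(* Let $n \ge 1$ and let $c, d_1, \dots, d_n$ be integers greater than $1$ such that $c$ is odd and each of $d_1, \dots, d_n$ is coprime with $c$. Consider the equation $$X + Y = c^z, \qquad ( * )$$ where $z \in \mathbb{Z}$, $X = \prod_{i=1}^n d_i^{x_i}$, $Y = \prod_{i=1}^n d_i^{y_i}$, with $x_i, y_i \in \mathbb{Z}$, $\max(x_i,y_i) > 0$ and $\min(x_i,y_i) = 0$ for every $1 \le i \le n$, and $X < Y$. Let $N$ be the number of solutions $(X,Y,z)$ to $( * )$, that is, the number of triples $(X,Y,z)$ satisfying $( * )$ for which such exponents $x_i, y_i$ exist. Then $$N \le 2^{n-1} + 1.$$ Moreover, if the set $\{\log(d_1), \log(d_2), \dots, \log(d_n)\}$ is linearly independent over $\mathbb{Z}$, then, letting $N_1$ be the number of solutions $(x_1, \dots, x_n, y_1, \dots, y_n, z)$ to $( * )$ (subject to the same conditions), we have $N_1 \le 2^{n-1} + 1$.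
   Context: Linear independence of $\{\log(d_1),\dots,\log(d_n)\}$ over $\mathbb{Z}$ means that the only integers $m_1,\dots,m_n$ with $\sum_{i} m_i \log d_i = 0$ are $m_1=\dots=m_n=0$. The $d_i$ are not required to be prime or pairwise coprime. *)

(* Defs.v *)
From HB Require Import structures.
From mathcomp Require Import all_boot all_order all_algebra.
From mathcomp Require Import all_classical all_reals all_analysis.
Set Implicit Arguments. Unset Strict Implicit. Unset Printing Implicit Defensive.
Import Order.TTheory GRing.Theory Num.Theory.
Local Open Scope classical_set_scope.
Local Open Scope ring_scope.

(* Powers are taken in rat, since in the ring int the inverse of a non-unit
   is that element itself, so a negative exponent would be misread there. *)
Definition prod_pow n (d : 'I_n -> int) (x : {ffun 'I_n -> int}) : rat :=
  \prod_(i < n) (d i)%:~R ^ x i.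

Definition exponents_solve n (c : int) (d : 'I_n -> int)
    (x y : {ffun 'I_n -> int}) (z : int) : Prop :=
  [/\ prod_pow d x + prod_pow d y = c%:~R ^ z,
      forall i, 0 < Num.max (x i) (y i),
      forall i, Num.min (x i) (y i) = 0
    & prod_pow d x < prod_pow d y].

Definition XYz_solutions n (c : int) (d : 'I_n -> int) : set (rat * rat * int) :=
  [set t | exists x y : {ffun 'I_n -> int},
     [/\ t.1.1 = prod_pow d x, t.1.2 = prod_pow d y
       & exponents_solve c d x y t.2]].

Definition xyz_solutions n (c : int) (d : 'I_n -> int) :
    set ({ffun 'I_n -> int} * {ffun 'I_n -> int} * int) :=
  [set t | exponents_solve c d t.1.1 t.1.2 t.2].

Definition linear_independent_over_int (R : realType) n (a : 'I_n -> R) : Prop :=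
  forall m : 'I_n -> int,
    \sum_(i < n) (m i)%:~R * a i = 0 -> forall i, m i = 0.

(* Main.v *)
Require Import Defs.
From HB Require Import structures.
From mathcomp Require Import all_boot all_order all_algebra.
From mathcomp Require Import all_classical all_reals all_analysis.
From mathcomp Require Import zify ring.

(** Write a solution as the vector f = x - y of Z^n, all of whose entries are
    nonzero, and let d^f be the product of the d_i^(f_i).  Since X + Y = c^z
    with z > 0, the class of d^f modulo c is -1.  Let M be the lattice of the
    vectors g with d^g = 1 or d^g = -1 modulo c.  As M is generated by at most
    n vectors, M / 2M has at most 2^n classes, and M is the union of its
    sublattice d^g = 1, which contains 2M, and of the coset d^g = -1, which
    contains the solutions.  Hence the solutions meet at most 2^(n-1) classes
    modulo 2M ([incongruent_coset_size]).  It remains to show that, after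
    removal of one well-chosen solution, a class contains at most one.

    Let (X1, Y1, z1) and (X2, Y2, z2) be in the same class.  Then X1 Y1 X2 Y2
    is a square, so Xj Yj = D sj^2 for a common D, and the element
    aj = Xj - Yj + 2 sj sqrt(-D) has norm c^(2 zj).  In terms of ideals,
    congruence modulo 2M says that, after one possible conjugation, a1 and a2
    generate powers of the same ideal of norm c.  Euclid's algorithm on the
    exponents ([common_base]) therefore gives a1 = +-w^s and a2 = +-w^t with
    s, t coprime.  The norm of w is the square of c^g, so
    w = (sqrt X + sqrt(-Y))^2 where X + Y = c^g; this makes the powers of w
    accessible to binomial expansions.

    All solutions involve the same primes, those dividing some d_i.  A prime
    dividing the imaginary part of w^s thus divides X Y or the imaginary part
    of w^t, and coprimality of s and t excludes the second case.  So neither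
    w^s nor w^t has, in its imaginary part, a prime foreign to X Y
    ([linked_base]).  This is very restrictive: for q an odd prime dividing
    s or t, the two factors of the imaginary part of w^q are powers of q,
    too small to be compatible with the norm unless q = 3.  One finds that
    s and t are 1, 2 or 3 ([im_supported_index]) and that two distinct
    solutions of a class are related in one of two explicit ways
    ([linked_pair]):
    - doubling: (X, X+1, z) and (1, 4X(X+1), 2z);
    - tripling: (3u, 9u+1, z) and (9u+1, 3^(4m+3) u, 3z), where 8u+1 = 9^m,
      as in 3 + 10 = 13 and 10 + 3^7 = 13^3.

    Finally only one solution of the whole equation can be the larger member
    of such a pair ([top_unique]).  Two doublings give two powers of c^2
    whose predecessors have the same prime divisors, and two triplings give
    the same situation for powers of 3, so the exponents agree by an
    elementary primitive divisor argument ([same_primes_pow_pred]).  A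
    doubling and a tripling are incompatible: if the exponent of c in the
    tripling is odd, then c + 1 is forced to be a power of 2, against
    c^z = 12u + 1; if it is even, then 2 y^2 + 1 = 3^(2m+1) for some y, whose
    only solution with m > 0 has y = 11 ([double_square_succ_pow3]), so that
    c = 11, and this case is excluded by the primes 7 and 19.

    Removing that one solution leaves at most 2^(n-1) of them.  When the
    logarithms are independent, (X, Y) determines the exponents, and the
    second bound follows from the first. *)

Set Implicit Arguments. Unset Strict Implicit. Unset Printing Implicit Defensive.
Import Order.TTheory GRing.Theory Num.Theory.
Local Open Scope ring_scope.

(** * The ring Z[sqrt(-D)] *)

(** A copy of the type of pairs of integers, because the latter already carries
    the product ring structure; the pair (a, b) stands for a + b sqrt(-D). *)
Definition quad (D : int) : Type := (int * int)%type.
HB.instance Definition _ D := GRing.Zmodule.copy (quad D) (int * int)%type.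

Section QuadRing.
Variable D : int.
Implicit Types x y z : quad D.
Definition quad_one : quad D := (1, 0).
Definition quad_mul x y : quad D :=
  (x.1 * y.1 - D * x.2 * y.2, x.1 * y.2 + x.2 * y.1).
Fact quad_mulA : associative quad_mul.
Proof. by move=> [a b] [a' b'] [a'' b'']; congr (_, _); rewrite /=; ring. Qed.
Fact quad_mulC : commutative quad_mul.
Proof. by move=> [a b] [a' b']; congr (_, _); rewrite /=; ring. Qed.
Fact quad_mul1 : left_id quad_one quad_mul.
Proof. by move=> [a b]; congr (_, _); rewrite /=; ring. Qed.
Fact quad_mulDl : left_distributive quad_mul +%R.
Proof. by move=> [a b] [a' b'] [a'' b'']; congr (_, _); rewrite /=; ring. Qed.
Fact quad_one_neq0 : quad_one != 0.
Proof. by []. Qed.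
HB.instance Definition _ := GRing.Zmodule_isComNzRing.Build (quad D)
  quad_mulA quad_mulC quad_mul1 quad_mulDl quad_one_neq0.

Lemma quad_fstM x y : (x * y).1 = x.1 * y.1 - D * x.2 * y.2. Proof. by []. Qed.
Lemma quad_sndM x y : (x * y).2 = x.1 * y.2 + x.2 * y.1. Proof. by []. Qed.
Definition qnorm x : int := x.1 ^+ 2 + D * x.2 ^+ 2.
Lemma qnormM x y : qnorm (x * y) = qnorm x * qnorm y.
Proof. by rewrite /qnorm quad_fstM quad_sndM; ring. Qed.
Lemma qnormX x k : qnorm (x ^+ k) = qnorm x ^+ k.
Proof. by elim: k => [|k IH]; [rewrite /qnorm /=; ring | rewrite !exprS qnormM IH]. Qed.
End QuadRing.

Lemma coprimez_modl (a b c : int) : (c %| a - b)%Z -> coprimez a c = coprimez b c.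
Proof.
move=> /dvdzP[q h]; have -> : a = q * c + b by rewrite -h; ring.
by rewrite ![coprimez _ c]coprimez_sym /coprimez gcdzMDl.
Qed.

Lemma dvdz_expr_self (c : int) k : (0 < k)%N -> (c %| c ^+ k)%Z.
Proof. by move=> k0; exact: dvdz_exp. Qed.

Section Directions.
Variables (D c : int).
Hypotheses (D_gt0 : 0 < D) (c_gt1 : 1 < c) (c_odd : ~~ (2 %| c)%Z).
Implicit Types x y : quad D.

(** Elements of norm c^(2k) divisible by no prime factor of c.  The parity
    conditions leave 1 and -1 as the only such elements of norm 1, including
    for D = 1, where i is excluded. *)
Definition primitive k x :=
  [/\ qnorm x = c ^+ (2 * k), coprimez x.1 c, ~~ (2 %| x.1)%Z & (2 %| x.2)%Z].

(** In terms of ideals: for each prime factor p of c, the elements x and y are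
    divisible by the same one of the two prime ideals above p.  Modulo c, the
    ratios x.1 / x.2 and y.1 / y.2 are square roots of -D, and they agree. *)
Definition codirected x y := (c %| x.1 * y.2 - y.1 * x.2)%Z.

Lemma primitive_coprime k x : (0 < k)%N -> primitive k x ->
  coprimez D c /\ coprimez x.2 c.
Proof.
move=> k0 [nx cx _ _].
have : coprimez (D * x.2 ^+ 2) c.
  rewrite (@coprimez_modl _ (- x.1 ^+ 2)) ?coprimeNz ?coprimezXl //.
  rewrite (_ : _ - _ = c ^+ (2 * k)); last by rewrite -nx /qnorm; ring.
  by rewrite dvdz_expr_self // muln_gt0.
by rewrite coprimezMl => /andP[-> h]; split=> //; move: h; rewrite coprimez_pexpl.
Qed.

Lemma norm1_even a b : a ^+ 2 + D * b ^+ 2 = 1 -> (2 %| b)%Z ->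
  b = 0 /\ (a = 1 \/ a = -1).
Proof.
move=> nx /dvdzP[b' hb]; rewrite hb in nx *; clear hb.
have b0 : b' = 0 by nia.
by rewrite b0 mul0r; split=> //; subst b'; nia.
Qed.

Lemma primitive0 x : primitive 0 x -> x = 1 \/ x = -1.
Proof.
case: x => a b [/= nx _ _ eb].
by have [/= -> [->|->]] := norm1_even nx eb; [left|right].
Qed.

(** The ideal of x is the 2k-th power of the ideal of norm c attached to its
    direction, and likewise for y, so x divides y.  The explicit proof checks
    that y times the conjugate of x is divisible by c^(2k). *)
Lemma primitive_div k l x y : (0 < k)%N -> (k <= l)%N ->
    primitive k x -> primitive l y -> codirected x y ->
  exists2 z, y = x * z & primitive (l - k) z /\ ((k < l)%N -> codirected x z).
Proof.
move=> k0 kl px py dxy.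
have [cD cx2] := primitive_coprime k0 px.
have [_ cy2] := primitive_coprime (leq_trans k0 kl) py.
case: (px) => nx cx ox ex; case: (py) => ny cy oy ey.
have ckl : c ^+ (2 * l) = c ^+ (2 * k) * c ^+ (2 * (l - k)).
  by rewrite -exprD; congr (_ ^+ _); lia.
have c2c : coprimez 2 c by rewrite coprimezE prime_coprime.
(* the product with the conjugate expression is divisible by c^(2k), and that
   conjugate expression is coprime to c because of codirectedness *)
have h2 : (c ^+ (2 * k) %| x.1 * y.2 - y.1 * x.2)%Z.
  have cop : coprimez (c ^+ (2 * k)) (x.1 * y.2 + y.1 * x.2).
    rewrite coprimezXl // coprimez_sym (@coprimez_modl _ (2 * x.1 * y.2)).
      by rewrite !coprimezMl c2c cx cy2.
    by rewrite (_ : _ - _ = - (x.1 * y.2 - y.1 * x.2)) ?rpredN //; ring.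
  rewrite -(Gauss_dvdzl _ cop) //.
  rewrite (_ : _ * _ = c ^+ (2 * k) * (y.2 ^+ 2 - c ^+ (2 * (l - k)) * x.2 ^+ 2)) ?dvdz_mulr //.
  transitivity (c ^+ (2 * k) * y.2 ^+ 2 - c ^+ (2 * l) * x.2 ^+ 2).
    by rewrite -nx -ny /qnorm; ring.
  by rewrite ckl; ring.
have h1 : (c ^+ (2 * k) %| x.1 * y.1 + D * x.2 * y.2)%Z.
  have cop : coprimez (c ^+ (2 * k)) x.1 by rewrite coprimezXl // coprimez_sym.
  rewrite -(Gauss_dvdzr _ cop).
  rewrite (_ : _ * _ = c ^+ (2 * k) * y.1 + D * x.2 * (x.1 * y.2 - y.1 * x.2)).
    by apply: rpredD; [apply: dvdz_mulr | apply: dvdz_mull].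
  by rewrite -nx /qnorm; ring.
have ck0 : c ^+ (2 * k) != 0 by rewrite expf_neq0 // gt_eqF // (lt_trans _ c_gt1).
(* h1 and h2 say that y times the conjugate of x is divisible by the norm of x *)
have [v hv] := dvdzP h2; have [u hu] := dvdzP h1.
have yE : y = x * ((u, v) : quad D).
  rewrite [LHS]surjective_pairing [RHS]surjective_pairing.
  congr (_, _); rewrite ?quad_fstM ?quad_sndM /=; apply: (mulIf ck0).
    transitivity (x.1 * (u * c ^+ (2 * k)) - D * x.2 * (v * c ^+ (2 * k))); last by ring.
    by rewrite -hu -hv -nx /qnorm; ring.
  transitivity (x.1 * (v * c ^+ (2 * k)) + x.2 * (u * c ^+ (2 * k))); last by ring.
  by rewrite -hu -hv -nx /qnorm; ring.
exists (u, v) => //.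
have nz : qnorm ((u, v) : quad D) = c ^+ (2 * (l - k)).
  by apply: (mulfI ck0); rewrite -ckl -ny -nx yE qnormM.
have y1E : y.1 = x.1 * u - D * x.2 * v by rewrite yE.
have y2E : y.2 = x.1 * v + u * x.2 by rewrite yE quad_sndM /= [u * _]mulrC.
have ev : (2 %| v)%Z.
  have : (2 %| c ^+ (2 * k) * v)%Z.
    by rewrite mulrC -hv; apply: rpredB; apply: dvdz_mull.
  by rewrite Gauss_dvdzr // coprimezXr.
(* y.2 is a unit modulo c and, when k < l, both norms vanish modulo c *)
have dz : (k < l)%N -> codirected x (u, v).
  move=> klt; rewrite /codirected -(@Gauss_dvdzl _ _ y.2) ?[coprimez c _]coprimez_sym // y2E /=.
  rewrite (_ : _ * _ = x.1 ^+ 2 * v ^+ 2 - u ^+ 2 * x.2 ^+ 2); last by ring.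
  rewrite (_ : _ - _ = v ^+ 2 * (x.1 ^+ 2 + D * x.2 ^+ 2)
      - x.2 ^+ 2 * (u ^+ 2 + D * v ^+ 2)); last by ring.
  move: (nz); rewrite /qnorm /= => ->; move: (nx); rewrite /qnorm => ->.
  by apply: rpredB; apply: dvdz_mull; apply: dvdz_expr_self; rewrite muln_gt0 ?subn_gt0.
split=> //; split=> //=.
  move: (kl); rewrite leq_eqVlt => /orP[/eqP kle|klt].
    move: nz; rewrite kle subnn muln0 expr0 /qnorm /= => nz.
    have [_ ] := norm1_even nz ev.
    by case=> ->; rewrite ?coprimeNz coprimezE coprime1n.
  have := dz klt; rewrite /codirected /= => hd.
  move: cy2; rewrite y2E (@coprimez_modl _ (2 * u * x.2)) ?coprimezMl.
    by case/andP => /andP[].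
  by rewrite (_ : _ - _ = x.1 * v - u * x.2) //; ring.
move: oy; apply: contraNN => ou.
by rewrite y1E; apply: rpredB; [apply: dvdz_mull|apply: dvdz_mull].
Qed.

(** Euclid's algorithm on the exponents of c, with the division of
    [primitive_div] as its step. *)
Lemma common_base k l x y : (0 < k)%N -> (0 < l)%N ->
    primitive k x -> primitive l y -> codirected x y ->
  exists g z s t, [/\ primitive g z, coprime s t, k = (g * s)%N /\ l = (g * t)%N,
    x = z ^+ s \/ x = - z ^+ s & y = z ^+ t \/ y = - z ^+ t].
Proof.
have [n] := ubnP (k + l)%N; elim: n => // n IH in k l x y *.
wlog kl : k l x y / (k <= l)%N.
  move=> H; case: (leqP k l) => [kl|lk]; first exact: H.
  move=> kln k0 l0 px py dxy.
  have dyx : codirected y x.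
    by move: (dxy); rewrite /codirected -rpredN opprB.
  rewrite addnC in kln.
  have [g [z [s [t [pz cst [kE lE] xE yE]]]]] := H _ _ _ _ (ltnW lk) kln l0 k0 py px dyx.
  by exists g, z, t, s; split=> //; rewrite coprime_sym.
rewrite ltnS => kln k0 l0 px py dxy.
have [w yE [pw dw]] := primitive_div k0 kl px py dxy.
move: (kl); rewrite leq_eqVlt => /orP[/eqP kle|klt].
  subst l; exists k, x, 1%N, 1%N; rewrite muln1 expr1; split=> //; first by left.
  by move: pw; rewrite subnn => /primitive0[] wE; rewrite yE wE; [left|right];
    rewrite ?mulrN mulr1.
have kln' : (k + (l - k) < n)%N by lia.
have lk0 : (0 < l - k)%N by rewrite subn_gt0.
have [g [z [s [t [pz cst [kE lE] xE wE]]]]] := IH _ _ _ _ kln' k0 lk0 px pw (dw klt).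
exists g, z, s, (s + t)%N; split=> //.
- by rewrite /coprime gcdnDl.
- by rewrite mulnDr -kE -lE subnKC.
by rewrite yE exprD; case: xE => ->; case: wE => ->; rewrite ?mulrN ?mulNr ?opprK; auto.
Qed.
End Directions.

(** * Divisibility of integers by primes *)

Lemma dvdzM_prime (p : nat) (a b : int) : prime p ->
  (p%:Z %| a * b)%Z = (p%:Z %| a)%Z || (p%:Z %| b)%Z.
Proof. by move=> pp; rewrite !dvdzE abszM Euclid_dvdM. Qed.

Lemma dvdzX_prime (p k : nat) (a : int) : prime p ->
  (p%:Z %| a ^+ k)%Z -> (p%:Z %| a)%Z.
Proof. by move=> pp; rewrite !dvdzE abszX Euclid_dvdX // => /andP[]. Qed.

Lemma coprimez_prime_dvdF (p : nat) (a b : int) : prime p -> coprimez a b ->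
  (p%:Z %| a)%Z -> (p%:Z %| b)%Z -> False.
Proof.
move=> pp; rewrite !dvdzE => /eqP ab pa pb.
have : (p %| gcdn `|a| `|b|)%N by rewrite dvdn_gcd pa pb.
by rewrite [gcdn _ _](_ : _ = 1%N) ?dvdn1; [case: eqP pp => // -> | apply/eqP; move/eqP: ab].
Qed.

Lemma absz_prime_power (q : nat) (a : int) : prime q -> a != 0 ->
  (forall p : nat, prime p -> (p%:Z %| a)%Z -> p = q) -> exists i, `|a|%N = (q ^ i)%N.
Proof.
move=> pq a0 H; have a0' : (0 < `|a|)%N by rewrite absz_gt0.
suff /p_natP [i ->] : q.-nat `|a|%N by exists i.
by apply/pnatP => // p pp pa; rewrite inE; apply/eqP; apply: H.
Qed.

Lemma prime_absz1 (a : int) : (forall p : nat, prime p -> ~~ (p%:Z %| a)%Z) ->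
  a = 1 \/ a = -1.
Proof.
move=> H; suff : `|a|%N = 1%N by lia.
have [a1|] := ltnP 1 `|a|; first by have := H _ (pdiv_prime a1); rewrite dvdzE pdiv_dvd.
case E : `|a|%N => [|[|]] // _.
by have := H 2%N isT; rewrite dvdzE E dvdn0.
Qed.

(** * Powers of (sqrt X + sqrt(-Y))^2 *)

Section Scale.
Variables (D D' m : int).
Hypothesis D'E : D' = D * m ^+ 2.
(** For D' = D m^2, this is the inclusion of Z[sqrt(-D')] into Z[sqrt(-D)]. *)
Definition scale (x : quad D') : quad D := (x.1, m * x.2).
Lemma scaleX x k : scale (x ^+ k) = scale x ^+ k.
Proof.
elim: k => [|k IH]; first by rewrite !expr0 /scale /= mulr0.
rewrite !exprS -IH /scale; move: (x ^+ k) => y.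
by congr (_, _); rewrite ?quad_fstM ?quad_sndM /= ?D'E; ring.
Qed.
End Scale.

Section Sequences.
Variables X Y : int.
(** The square of sqrt X + sqrt(-Y). *)
Definition binom_sq : quad (X * Y) := (X - Y, 2).
Definition re k : int := (binom_sq ^+ k).1.
Definition im k : int := (binom_sq ^+ k).2.
(** The odd power (sqrt X + sqrt(-Y))^(2k+1) is
    cofX k * sqrt X + cofY k * sqrt(-Y). *)
Definition cofX k : int := re k - Y * im k.
Definition cofY k : int := re k + X * im k.

Lemma reS k : re k.+1 = (X - Y) * re k - 2 * (X * Y) * im k.
Proof. by rewrite /re exprS quad_fstM /= -/(im k); ring. Qed.
Lemma imS k : im k.+1 = (X - Y) * im k + 2 * re k.
Proof. by rewrite /im exprS quad_sndM /= -/(re k); ring. Qed.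
Lemma reD s t : re (s + t) = re s * re t - X * Y * im s * im t.
Proof. by rewrite /re exprD quad_fstM. Qed.
Lemma imD s t : im (s + t) = re s * im t + re t * im s.
Proof. by rewrite /im exprD quad_sndM [_.2 * _]mulrC. Qed.
Lemma re0 : re 0 = 1. Proof. by []. Qed.
Lemma im0 : im 0 = 0. Proof. by []. Qed.
Lemma re1 : re 1 = X - Y. Proof. by []. Qed.
Lemma im1 : im 1 = 2. Proof. by []. Qed.

Lemma norm_re_im k : re k ^+ 2 + X * Y * im k ^+ 2 = (X + Y) ^+ (2 * k).
Proof.
rewrite -/(qnorm (binom_sq ^+ k)) qnormX exprM; congr (_ ^+ k).
by rewrite /qnorm /=; ring.
Qed.

(** Both sides are the squared modulus of (sqrt X + sqrt(-Y))^(2k+1). *)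
Lemma norm_cofactors k : X * cofX k ^+ 2 + Y * cofY k ^+ 2 = (X + Y) ^+ (2 * k).+1.
Proof. by rewrite [RHS]exprS -norm_re_im /cofX /cofY; ring. Qed.
Lemma im_double k : im (2 * k) = 2 * re k * im k.
Proof. by rewrite mul2n -addnn imD; ring. Qed.
Lemma re_double k : re (2 * k) = re k ^+ 2 - X * Y * im k ^+ 2.
Proof. by rewrite mul2n -addnn reD; ring. Qed.
Lemma im_odd k : im (2 * k).+1 = 2 * cofX k * cofY k.
Proof. by rewrite imS im_double re_double /cofX /cofY; ring. Qed.
Lemma re_odd k : re (2 * k).+1 = X * cofX k ^+ 2 - Y * cofY k ^+ 2.
Proof. by rewrite reS im_double re_double /cofX /cofY; ring. Qed.

Lemma im_dvd r t : (im r %| im (t * r))%Z.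
Proof.
elim: t => [|t IH]; first by rewrite mul0n im0 dvdz0.
by rewrite mulSn imD; apply: rpredD; [apply: dvdz_mull | apply: dvdz_mull].
Qed.

(** Binomial expansion of (sqrt X + sqrt(-Y))^(2k), keeping the terms without a
    factor X; the second formula is multiplied by Y to avoid the exponent k - 1. *)
Lemma re_im_modX k : exists r s,
  re k = (- Y) ^+ k + X * r /\ Y * im k = - (2 * k%:Z) * (- Y) ^+ k + X * s.
Proof.
elim: k => [|k [r [s [ur vs]]]].
  by exists 0, 0; rewrite re0 im0; split; ring.
exists (re k - Y * r - 2 * Y * im k), (Y * im k - Y * s + 2 * Y * r).
have wE : (- Y) ^+ k = re k - X * r by rewrite ur; ring.
have kE : 2 * k%:Z * (- Y) ^+ k = X * s - Y * im k by rewrite vs; ring.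
rewrite reS imS exprS intS; split; first by rewrite wE; ring.
transitivity (Y * (2 * k%:Z * (- Y) ^+ k + 2 * (- Y) ^+ k) + 
    X * (Y * im k - Y * s + 2 * Y * r)); last by ring.
by rewrite kE wE; ring.
Qed.

Lemma cofX_modX k : exists r, cofX k = (2 * k).+1%:Z * (- Y) ^+ k + X * r.
Proof.
have [r [s [ur vs]]] := re_im_modX k; exists (r - s).
by rewrite /cofX ur vs intS PoszM; ring.
Qed.

(** Binomial expansion of (sqrt X + sqrt(-Y))^(2k), keeping the terms without a
    factor X^2.  The factors 3 and Y clear the denominators of the binomial
    coefficient C(2k, 3) and the negative powers of Y. *)
Lemma re_im_modX2 k : exists r s,
  3 * Y * re k = (- Y) ^+ k * 3 * (Y - k%:Z * (2 * k%:Z - 1) * X) + X ^+ 2 * r /\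
  3 * Y ^+ 2 * im k =
    (- Y) ^+ k * (- 6 * k%:Z * Y + 2 * k%:Z * (2 * k%:Z - 1) * (k%:Z - 1) * X) + X ^+ 2 * s.
Proof.
elim: k => [|k [r [s [ur vs]]]].
  by exists 0, 0; rewrite re0 im0; split; ring.
have hu : 3 * Y * re k.+1 = (X - Y) * (3 * Y * re k) - 2 * X * (3 * Y ^+ 2 * im k).
  by rewrite reS; ring.
have hv : 3 * Y ^+ 2 * im k.+1 = (X - Y) * (3 * Y ^+ 2 * im k) + 2 * Y * (3 * Y * re k).
  by rewrite imS; ring.
rewrite hu hv ur vs [(- Y) ^+ k.+1]exprS intS.
move: ((- Y) ^+ k) => w; move: (k%:Z) => n.
(* the witnesses collect the terms divisible by X^2 *)
exists ((X - Y) * r - 2 * X * s - 3 * w * n * (2 * n - 1) - 4 * w * n * (2 * n - 1) * (n - 1)).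
exists ((X - Y) * s + 2 * Y * r + 2 * w * n * (2 * n - 1) * (n - 1)).
by split; ring.
Qed.

Lemma cofX_modX2 k : exists r, 3 * Y * cofX k =
  (- Y) ^+ k * (2 * k).+1%:Z * (3 * Y - k%:Z * (2 * k%:Z - 1) * X) + X ^+ 2 * r.
Proof.
have [r [s [ur vs]]] := re_im_modX2 k; exists (r - s).
transitivity (3 * Y * re k - 3 * Y ^+ 2 * im k); first by rewrite /cofX; ring.
by rewrite ur vs intS PoszM; ring.
Qed.

End Sequences.

(** Exchanging X and Y replaces the base by the opposite of its conjugate. *)
Lemma re_im_swap X Y k :
  re Y X k = (-1) ^+ k * re X Y k /\ im Y X k = - (-1) ^+ k * im X Y k.
Proof.
elim: k => [|k [ur vs]]; first by rewrite !re0 !im0; split; ring.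
by rewrite !reS !imS ur vs exprS; split; ring.
Qed.

Lemma cofX_swap X Y k : cofX Y X k = (-1) ^+ k * cofY X Y k.
Proof. by have [ur vs] := re_im_swap X Y k; rewrite /cofX /cofY ur vs; ring. Qed.

(** * Indices whose imaginary part has no new prime divisor *)

(** The index t brings no prime foreign to X Y.  As with primitive divisors of Lucas
    sequences, this forces t to be small. *)
Definition im_supported X Y t := forall p : nat, prime p ->
  (p%:Z %| im X Y t)%Z -> (p%:Z %| X * Y)%Z.

Lemma im_supported_dvd X Y r t : im_supported X Y (t * r) -> im_supported X Y r.
Proof. by move=> H p pp pr; apply: H => //; apply: dvdz_trans pr (im_dvd _ _ _ _). Qed.

Lemma prime_dvd_sum_prod_absurd X Y p k : prime p -> coprimez X Y ->
  (p%:Z %| (X + Y) ^+ k)%Z -> (p%:Z %| X * Y)%Z -> False.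
Proof.
move=> pp cXY /(dvdzX_prime pp) ps; rewrite dvdzM_prime // => /orP[] h.
  by apply: (coprimez_prime_dvdF pp cXY h); move: (rpredB ps h); rewrite addrC addKr.
by apply: (coprimez_prime_dvdF pp cXY _ h); move: (rpredB ps h); rewrite addrK.
Qed.

(** A prime divisor of re r divides im (2r), hence X Y, hence the norm (X + Y)^(2r);
    this contradicts the coprimality of X and Y. *)
Lemma im_supported_double X Y r : coprimez X Y -> im_supported X Y (2 * r) ->
  re X Y r = 1 \/ re X Y r = -1.
Proof.
move=> cXY H; apply: prime_absz1 => p pp; apply/negP => pr.
have pXY : (p%:Z %| X * Y)%Z.
  by apply: H => //; rewrite im_double; apply: dvdz_mulr; apply: dvdz_mull.
apply: (@prime_dvd_sum_prod_absurd X Y p (2 * r)) => //; rewrite -norm_re_im.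
by apply: rpredD; [apply: dvdz_mulr | apply: dvdz_mulr].
Qed.

(** A prime p dividing the cofactor divides X, since dividing Y it would divide
    X + Y.  Modulo X the cofactor is q (-Y)^k, so p = q. *)
Lemma cofX_prime_power X Y k : coprimez X Y -> 0 < Y -> cofX X Y k != 0 -> prime (2 * k).+1 ->
    (forall p : nat, prime p -> (p%:Z %| cofX X Y k)%Z -> (p%:Z %| X * Y)%Z) ->
  exists i, [/\ `|cofX X Y k|%N = ((2 * k).+1 ^ i)%N,
    (0 < i)%N -> ((2 * k).+1%:Z %| X)%Z & (1 < k)%N -> (i <= 1)%N].
Proof.
set q := (2 * k).+1 => cXY Y0 c0 pq H.
have pX p : prime p -> (p%:Z %| cofX X Y k)%Z -> (p%:Z %| X)%Z /\ p = q.
  move=> pp pc; have := H p pp pc; rewrite dvdzM_prime //.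
  have [pX|npX] /= := boolP (p%:Z %| X)%Z; last first.
    move=> pY; exfalso; apply: (@prime_dvd_sum_prod_absurd X Y p (2 * k).+1) => //.
      rewrite -norm_cofactors; apply: rpredD; last exact: dvdz_mulr.
      by apply: dvdz_mull; rewrite expr2; apply: dvdz_mull.
    exact: dvdz_mull.
  move=> _; split=> //; have [r cE] := cofX_modX X Y k.
  have : (p%:Z %| q%:Z * (- Y) ^+ k)%Z.
    have -> : q%:Z * (- Y) ^+ k = cofX X Y k - X * r by rewrite cE -/q; ring.
    by apply: rpredB => //; apply: dvdz_mulr.
  rewrite dvdzM_prime // => /orP[|/(dvdzX_prime pp)].
    by rewrite dvdzE /= dvdn_prime2 // => /eqP.
  by rewrite rpredN => /(coprimez_prime_dvdF pp cXY pX).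
have [i iE] := absz_prime_power pq c0 (fun p pp pc => (pX p pp pc).2).
exists i; split=> //.
  move=> i0; apply: (pX q pq _).1; rewrite dvdzE iE /=; exact: dvdn_exp.
(* for q >= 5, the expansion modulo X^2 shows that q^2 does not divide the cofactor *)
move=> k1; rewrite leqNgt; apply/negP => i2.
have qc : (q%:Z ^+ 2 %| cofX X Y k)%Z.
  by rewrite dvdzE iE abszX dvdn_exp2l.
have [x xE] := dvdzP (pX q pq (dvdz_trans (dvdz_exp (isT : (0 < 2)%N) (dvdzz _)) qc)).1.
have [r rE] := cofX_modX2 X Y k.
have qX : (q%:Z %| X)%Z by rewrite xE dvdz_mull.
have : (q%:Z ^+ 2 %| q%:Z * (3 * Y * (- Y) ^+ k))%Z.
  have -> : q%:Z * (3 * Y * (- Y) ^+ k) = 3 * Y * cofX X Y k +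
     q%:Z ^+ 2 * ((- Y) ^+ k * (k%:Z * (2 * k%:Z - 1) * x) - x ^+ 2 * r).
    rewrite rE -/q; move: (q%:Z) xE => q' xE; move: ((- Y) ^+ k) => w.
    by rewrite xE; ring.
  by apply: rpredD; [apply: dvdz_mull | apply: dvdz_mulr].
have q0 : q%:Z != 0 by rewrite /q.
rewrite expr2 dvdz_mul2l // dvdzM_prime //.
have nqY : ~~ (q%:Z %| Y)%Z by apply/negP => /(coprimez_prime_dvdF pq cXY qX).
rewrite [(_ %| 3 * _)%Z]dvdzM_prime // (negPf nqY) orbF => /orP[|/(dvdzX_prime pq)].
  by rewrite dvdzE /= => /dvdn_leq; lia.
by rewrite rpredN (negPf nqY).
Qed.

(** The pairs with cofY 1 = -1 and cofX 1 a power of 3, up to sign; for m = 1 this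
    is 3 + 10 = 13. *)
Definition tripling_base (X Y : int) := exists m u : nat,
  [/\ (0 < m)%N, (8 * u + 1 = 9 ^ m)%N, X = 3 * u%:Z & Y = 9 * u%:Z + 1].

(** The cofactors are X - 3Y and 3X - Y.  With 3X - Y = 1 or -1 the first one is
    -8X + 3 or -8X - 3, and the powers of 3 are 1 or 3 modulo 8. *)
Lemma tripling_base_of_cofactors (X Y : int) i : 0 < X -> 0 < Y ->
  `|cofX X Y 1|%N = (3 ^ i)%N -> `|cofY X Y 1|%N = 1%N -> tripling_base X Y.
Proof.
have -> : cofX X Y 1 = X - 3 * Y by rewrite /cofX re1 im1; ring.
have -> : cofY X Y 1 = 3 * X - Y by rewrite /cofY re1 im1; ring.
move=> X0 Y0 hA hB.
case: i hA => [|i] hA; first by rewrite expn0 in hA; lia.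
have m8 j : (3 ^ (2 * j) %% 8 = 1)%N by rewrite expnM -modnXm exp1n.
have i8 : (3 ^ i %% 8 = if odd i then 3 else 1)%N.
  rewrite -{1}(odd_double_half i) expnD -mul2n -modnMmr m8 muln1.
  by case: (odd i).
rewrite expnS in hA; move: i8 hA; case: ifP => oi; move NE : (3 ^ i)%N => N N8 hA.
  by exfalso; lia.
exists (i./2), `|(X %/ 3)%Z|%N.
have NE' : N = (9 ^ i./2)%N.
  by rewrite -NE -{1}(odd_double_half i) oi add0n -mul2n expnM.
have i0 : (0 < i./2)%N.
  by rewrite lt0n; apply/eqP => i0; rewrite i0 in NE'; lia.
by rewrite -NE'; split=> //; lia.
Qed.

Lemma ltn_sqr_expn9 k : (1 < k)%N -> ((2 * k).+1 ^ 2 < 9 ^ k)%N.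
Proof.
elim: k => // -[//|[//|k]] IH _.
by have := IH isT; rewrite [(9 ^ k.+3)%N]expnS; move: (9 ^ _)%N => n; nia.
Qed.

(** The two cofactors of index q are powers of q up to sign, one of them is a unit,
    and for q >= 5 the other is at most q.  Then the identity of
    [norm_cofactors] is impossible by size, except for q = 3. *)
Lemma im_supported_odd_prime (X Y : int) k : 0 < X -> 0 < Y -> 3 <= X + Y -> coprimez X Y ->
  prime (2 * k).+1 -> im_supported X Y (2 * k).+1 ->
  k = 1%N /\ (tripling_base X Y \/ tripling_base Y X).
Proof.
move=> X0 Y0 s3 cXY pq H.
have Hc p : prime p -> (p%:Z %| cofX X Y k)%Z \/ (p%:Z %| cofY X Y k)%Z -> (p%:Z %| X * Y)%Z.
  move=> pp h; apply: H => //; rewrite im_odd -mulrA; apply: dvdz_mull.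
  by case: h => h; [apply: dvdz_mulr | apply: dvdz_mull].
have nz : cofX X Y k * cofY X Y k != 0.
  apply/negP => /eqP AB0; have s1 : (1 < `|(X + Y)%R|)%N by lia.
  have pp := pdiv_prime s1; apply: (@prime_dvd_sum_prod_absurd X Y _ 1 pp cXY).
    by rewrite expr1 dvdzE pdiv_dvd.
  by apply: H => //; rewrite im_odd -mulrA AB0 mulr0 dvdz0.
have swp : `|cofX Y X k|%N = `|cofY X Y k|%N by rewrite cofX_swap abszMsign.
move: nz; rewrite mulf_eq0 negb_or => /andP[A0 B0].
have B0' : cofX Y X k != 0 by rewrite -absz_eq0 swp absz_eq0.
have [i [iE iX ik]] := cofX_prime_power cXY Y0 A0 pq (fun p pp h => Hc p pp (or_introl h)).
have HcY p : prime p -> (p%:Z %| cofX Y X k)%Z -> (p%:Z %| Y * X)%Z.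
  by move=> pp; rewrite [Y * X]mulrC dvdzE swp => h; apply: Hc => //; right.
rewrite coprimez_sym in cXY.
have [j [jE jY jk]] := cofX_prime_power cXY X0 B0' pq HcY.
rewrite swp in jE.
(* q cannot divide both X and Y *)
have ij : i = 0%N \/ j = 0%N.
  case: (posnP i) => [|i0]; [by left|]; case: (posnP j) => [|j0]; [by right|].
  by have := coprimez_prime_dvdF pq cXY (jY j0) (iX i0).
have k0 : (0 < k)%N by case: (k) pq.
have nrm := norm_cofactors X Y k.
have [k1|k1] := ltnP 1 k.
  exfalso.
  (* both cofactors are at most q in absolute value, so that (X + Y)^q is at most
     q^2 (X + Y), against X + Y >= 3 *)
  have le_q (a : int) l : `|a|%N = ((2 * k).+1 ^ l)%N -> (l <= 1)%N ->
      a ^+ 2 <= ((2 * k).+1 ^ 2)%N%:Z.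
    move=> aE l1; rewrite -[a ^+ 2]ger0_norm ?sqr_ge0 // -abszE abszX lez_nat.
    rewrite leq_exp2r // aE -[X in (_ <= X)%N]expn1; exact: leq_pexp2l.
  have A2 := le_q _ _ iE (ik k1); have B2 := le_q _ _ jE (jk k1).
  have : (9 ^ k)%N%:Z <= (X + Y) ^+ (2 * k).
    have -> : (9 ^ k)%N%:Z = (3 : int) ^+ (2 * k) by rewrite -natz natrX exprM.
    by rewrite lerXn2r ?nnegrE //; lia.
  have := ltn_sqr_expn9 k1; rewrite -ltz_nat.
  move: nrm; rewrite [(X + Y) ^+ _.+1]exprS; move: A2 B2.
  move: ((_.+1 ^ 2)%N%:Z) ((9 ^ k)%N%:Z) => Q N.
  move: (_ ^+ 2) (_ ^+ 2) ((X + Y) ^+ _) => B A S A2 B2 nrm QN NS.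
  have hA : X * A <= X * Q by rewrite ler_pM2l.
  have hB : Y * B <= Y * Q by rewrite ler_pM2l.
  have hS : (X + Y) * Q < (X + Y) * S by rewrite ltr_pM2l ?addr_gt0 // (lt_le_trans QN).
  by rewrite -nrm mulrDl in hS; move: (lerD hA hB); rewrite leNgt hS.
have k1E : k = 1%N by lia.
subst k; split=> //.
case: ij => e.
  right; apply: (@tripling_base_of_cofactors Y X j) => //; first by rewrite swp jE.
  have swp' : `|cofX X Y 1|%N = `|cofY Y X 1|%N by rewrite cofX_swap abszMsign.
  by rewrite -swp' iE e.
by left; apply: (@tripling_base_of_cofactors X Y i) => //; rewrite jE e.
Qed.

Lemma im_supported_swap X Y t : im_supported X Y t -> im_supported Y X t.
Proof.
move=> H p pp; have [_ ->] := re_im_swap X Y t.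
by rewrite mulNr rpredN dvdzE abszMsign [Y * X]mulrC; apply: H.
Qed.

(** An odd power of sqrt X + sqrt(-Y) is again of the form sqrt X' + sqrt(-Y'). *)
Lemma im_rebase (X Y : int) j k :
  im X Y ((2 * j).+1 * k) = cofX X Y j * cofY X Y j *
    im (X * cofX X Y j ^+ 2) (Y * cofY X Y j ^+ 2) k.
Proof.
set A := cofX X Y j; set B := cofY X Y j.
have DE : X * A ^+ 2 * (Y * B ^+ 2) = X * Y * (A * B) ^+ 2 by ring.
have gE : binom_sq X Y ^+ (2 * j).+1 = scale (X * Y) (A * B) (binom_sq (X * A ^+ 2) (Y * B ^+ 2)).
  rewrite [LHS]surjective_pairing -/(re X Y _) -/(im X Y _) re_odd im_odd -/A -/B.
  by rewrite /scale /=; congr (_, _); ring.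
by rewrite /im exprM gE -(scaleX DE).
Qed.

(** Otherwise the cube of the base would again be a tripling base, with the same Y,
    but X is determined by Y in such a pair. *)
Lemma tripling_base_not_im_supported9 (X Y : int) : 0 < X -> coprimez X Y -> tripling_base X Y ->
  ~ im_supported X Y 9.
Proof.
move=> X0 cXY [m [u [m0 uE XE YE]]] H.
have AE : cofX X Y 1 = - (24 * u%:Z + 3) by rewrite /cofX re1 im1 XE YE; ring.
have BE : cofY X Y 1 = -1 by rewrite /cofY re1 im1 XE YE; ring.
set X3 := X * cofX X Y 1 ^+ 2; have Y3E : Y * cofY X Y 1 ^+ 2 = Y by rewrite BE; ring.
have A0 : cofX X Y 1 != 0 by rewrite AE; lia.
have X30 : 0 < X3 by rewrite mulr_gt0 // lt_neqAle eq_sym expf_neq0 // sqr_ge0.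
have Y30 : 0 < Y by lia.
have H3 : im_supported X3 Y 3.
  move=> p pp pi; have : (p%:Z %| X * Y)%Z.
    apply: H => //; rewrite (_ : 9 = (2 * 1).+1 * 3)%N // im_rebase Y3E.
    exact: dvdz_mull.
  by rewrite !dvdzM_prime // => /orP[]->; rewrite ?orbT.
have c3 : coprimez X3 Y.
  rewrite coprimezMl cXY coprimezXl // (@coprimez_modl _ X) //.
  by rewrite /cofX re1 im1 dvdzE; apply/dvdzP; exists (-3); ring.
have s3 : 3 <= X3 + Y by lia.
have [_ [] [m' [u' [_ _ XE' YE']]]] := im_supported_odd_prime (k := 1) X30 Y30 s3 c3 isT H3.
  have uu : u' = u by lia.
  by move: XE'; rewrite uu -XE /X3 AE; nia.
by lia.
Qed.

(** The property passes to divisors of t, and it fails for 4, 6, 9 and the primes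
    above 3. *)
Lemma im_supported_index (X Y : int) t : 0 < X -> 0 < Y -> 3 <= X + Y -> coprimez X Y ->
  (0 < t)%N -> im_supported X Y t ->
  [\/ t = 1%N, t = 2%N /\ (X - Y = 1 \/ X - Y = -1)
    | t = 3%N /\ (tripling_base X Y \/ tripling_base Y X)].
Proof.
move=> X0 Y0 s3 cXY t0 Ht.
have g2 : im_supported X Y 2 -> X - Y = 1 \/ X - Y = -1.
  by move=> H2; rewrite -re1; apply: (@im_supported_double X Y 1).
have g3 : im_supported X Y 3 -> tripling_base X Y \/ tripling_base Y X.
  by move=> H3; have [] := im_supported_odd_prime (k := 1) X0 Y0 s3 cXY isT H3.
have n4 : ~ im_supported X Y 4.
  move=> H4; have := g2 (@im_supported_dvd X Y 2 2 H4); have := @im_supported_double X Y 2 cXY H4.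
  by rewrite (_ : 2 = 2 * 1)%N // re_double re1 im1; nia.
have n9 : ~ im_supported X Y 9.
  move=> H9; case: (g3 (@im_supported_dvd X Y 3 3 H9)) => tr.
    exact: (tripling_base_not_im_supported9 X0 cXY tr H9).
  by apply: (tripling_base_not_im_supported9 Y0 _ tr (im_supported_swap H9)); rewrite coprimez_sym.
have n6 : ~ im_supported X Y 6.
  move=> H6; have h2 := g2 (@im_supported_dvd X Y 2 3 H6).
  by case: (g3 (@im_supported_dvd X Y 3 2 H6)) => -[m [u [m0 uE XE YE]]]; case: u uE XE YE; lia.
have prime23 r q : prime q -> im_supported X Y (r * q) -> q = 2%N \/ q = 3%N.
  move=> pq /im_supported_dvd gq; have [q2|oq] := even_prime pq; [by left|right].
  have qE : q = (2 * q./2).+1 by rewrite -[LHS]odd_double_half oq add1n mul2n.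
  rewrite qE in gq pq *; have [k1 _] := im_supported_odd_prime X0 Y0 s3 cXY pq gq.
  by rewrite k1.
have [t1|t1] := leqP t 1; first by constructor 1; lia.
have pq := pdiv_prime t1; move: (pdiv_dvd t); move: (pdiv t) pq => q pq /dvdnP[r tE].
rewrite tE in Ht t0.
have [r1|r1] := leqP r 1.
  have r1E : r = 1%N by lia.
  rewrite r1E mul1n in tE Ht; rewrite tE.
  have [|qE|qE] := prime23 1%N q pq; first by rewrite mul1n.
    by constructor 2; rewrite qE in Ht *; split=> //; apply: g2.
  by constructor 3; rewrite qE in Ht *; split=> //; apply: g3.
exfalso; have pq' := pdiv_prime r1.
move: (pdiv_dvd r); move: (pdiv r) pq' => q' pq' /dvdnP[r' rE].
have h1 := prime23 _ _ pq Ht.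
have h2 : q' = 2%N \/ q' = 3%N.
  by apply: (prime23 (r' * q)%N) => //; rewrite mulnAC -rE.
move: Ht; rewrite rE -mulnA => /im_supported_dvd.
by case: h1 => ->; case: h2 => ->.
Qed.

(** * Two solutions in the same class *)

Lemma coprime_mul_square u v w : (0 < u)%N -> coprime u v -> (u * v = w ^ 2)%N ->
  u = (gcdn u w ^ 2)%N.
Proof.
move=> u0 cuv uvw; set k := gcdn u w.
have k0 : (0 < k)%N by rewrite gcdn_gt0 u0.
have [u' uE] := dvdnP (dvdn_gcdl u w : k %| u)%N.
have [w' wE] := dvdnP (dvdn_gcdr u w : k %| w)%N.
have cuw : coprime u' w'.
  have := muln_gcdl u' w' k; rewrite -uE -wE -/k => /eqP.
  by rewrite -[X in _ == X]mul1n eqn_pmul2r.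
have e : (u' * v = k * w' ^ 2)%N.
  apply/eqP; rewrite -(eqn_pmul2l k0) mulnA [(k * u')%N]mulnC -uE uvw wE expnMn.
  by apply/eqP; lia.
have d1 : (u' %| k)%N.
  by rewrite -(Gauss_dvdl _ (coprimeXr 2 cuw)) -e dvdn_mulr.
have d2 : (k %| u')%N.
  rewrite -(@Gauss_dvdl _ _ v) ?e ?dvdn_mulr //.
  by apply: coprime_dvdl cuv; rewrite dvdn_gcdl.
by rewrite {1}uE; congr (_ * _)%N; apply/eqP; rewrite eqn_dvd d1 d2.
Qed.

(** D is the gcd of m1 and m2: the cofactors are coprime and their product is a
    square. *)
Lemma common_squarefree_part m1 m2 a b : (0 < m1)%N -> (0 < m2)%N -> (0 < a)%N ->
  (m1 * m2 * a ^ 2 = b ^ 2)%N ->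
  exists D s1 s2, [/\ (0 < D)%N, m1 = (D * s1 ^ 2)%N, m2 = (D * s2 ^ 2)%N
    & (D * s1 * s2 * a)%N = b].
Proof.
move=> m10 m20 a0 h; set D := gcdn m1 m2.
have D0 : (0 < D)%N by rewrite gcdn_gt0 m10.
have [u uE] := dvdnP (dvdn_gcdl m1 m2 : D %| m1)%N.
have [v vE] := dvdnP (dvdn_gcdr m1 m2 : D %| m2)%N.
have cuv : coprime u v.
  have := muln_gcdl u v D; rewrite -uE -vE -/D => /eqP.
  by rewrite -[X in _ == X]mul1n eqn_pmul2r.
have u0 : (0 < u)%N by move: m10; rewrite uE muln_gt0 => /andP[].
have v0 : (0 < v)%N by move: m20; rewrite vE muln_gt0 => /andP[].
have h' : (u * v * (D * a) ^ 2 = b ^ 2)%N by rewrite -h uE vE; lia.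
have /dvdnP[w wE] : (D * a %| b)%N by rewrite -(@dvdn_pexp2r _ _ 2) // -h' dvdn_mull.
have uvw : (u * v = w ^ 2)%N.
  apply/eqP; rewrite -(@eqn_pmul2r ((D * a) ^ 2)) ?expn_gt0 ?muln_gt0 ?D0 ?a0 //.
  by rewrite h' wE expnMn.
have us := coprime_mul_square u0 cuv uvw.
have vs : v = (gcdn v w ^ 2)%N.
  by apply: (@coprime_mul_square v u) => //; rewrite 1?coprime_sym 1?mulnC.
exists D, (gcdn u w), (gcdn v w); split=> //; rewrite -?us -?vs 1?mulnC //.
have ww : (gcdn u w * gcdn v w = w)%N.
  by apply/eqP; rewrite -(@eqn_exp2r _ _ 2) // expnMn -us -vs uvw.
by rewrite wE -[RHS]mulnC -{3}ww; lia.
Qed.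

(** P is the set of primes that divide some d_i; since each d_i occurs in X or in Y,
    all solutions have this same set of primes. *)
Definition solution (c : nat) (P : pred nat) (X Y z : nat) :=
  [/\ (0 < X < Y)%N, (X + Y = c ^ z)%N, coprime X c
    & forall p, prime p -> (p %| X * Y)%N = P p].

(** Congruence of the exponent vectors modulo 2M, read on X and Y: Gp / Gm is d^g,
    where 2g is the difference of the exponent vectors. *)
Definition linked (c X1 Y1 X2 Y2 : nat) := exists Gp Gm : nat,
  [/\ (0 < Gm)%N, coprime Gm c, (X1 * Y2 * Gm ^ 2 = X2 * Y1 * Gp ^ 2)%N
    & (c%:Z %| Gp%:Z - Gm%:Z)%Z \/ (c%:Z %| Gp%:Z + Gm%:Z)%Z].

Section Pair.
Variables (c : nat) (P : pred nat).
Hypotheses (c_gt1 : (1 < c)%N) (c_odd : odd c).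

Lemma solution_exp_gt0 X Y z : solution c P X Y z -> (0 < z)%N.
Proof. by case=> /andP[X0 XY] s _ _; case: z s => //; rewrite expn0; lia. Qed.

Lemma solution_odd X Y z : solution c P X Y z -> odd (X + Y).
Proof. by case=> _ -> _ _; rewrite oddX c_odd orbT. Qed.

Lemma coprime_sum_pow X Y z : (0 < z)%N -> (X + Y = c ^ z)%N -> coprime X c ->
  coprime Y c /\ coprime X Y.
Proof.
move=> z0 s Xc; have XS : coprime X (X + Y) by rewrite s coprimeXr.
have cXY : coprime X Y by move: XS; rewrite /coprime gcdnDl.
split=> //; rewrite -(coprime_pexpr _ _ z0) -s /coprime.
by rewrite gcdnDr; rewrite /coprime gcdnC in cXY *.
Qed.

(** W = D s1 s2 satisfies W Gm = X2 Y1 Gp, so W = +-X2 Y1 modulo c; the sign of s1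
    is chosen to have W = X2 Y1. *)
Lemma codirected_of_linked X1 Y1 z1 X2 Y2 z2 :
    solution c P X1 Y1 z1 -> solution c P X2 Y2 z2 -> linked c X1 Y1 X2 Y2 ->
  exists D s1 s2 : int, [/\ 0 < D, X1%:Z * Y1%:Z = D * s1 ^+ 2,
    X2%:Z * Y2%:Z = D * s2 ^+ 2 & (c%:Z %| X1%:Z * s2 - X2%:Z * s1)%Z].
Proof.
move=> S1 S2 [Gp [Gm [Gm0 cG hG dG]]].
have z10 := solution_exp_gt0 S1; have z20 := solution_exp_gt0 S2.
case: S1 => /andP[X10 XY1] s1 cX1 _; case: S2 => /andP[X20 XY2] s2 cX2 _.
have Y10 : (0 < Y1)%N by lia.
have [cY1 _] := coprime_sum_pow z10 s1 cX1.
have m10 : (0 < X1 * Y1)%N by rewrite muln_gt0 X10.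
have m20 : (0 < X2 * Y2)%N by rewrite muln_gt0 X20; lia.
(* a1 or its opposite is chosen below, according to the sign in d^g = 1 or -1 *)
have [|D [a1 [a2 [D0 E1 E2 E]]]] := common_squarefree_part (b := X2 * Y1 * Gp) m10 m20 Gm0.
  transitivity (X2 * Y1 * (X1 * Y2 * Gm ^ 2))%N; first by ring.
  by rewrite hG; ring.
have cDa : coprimez (D%:Z * a1%:Z) c.
  rewrite -PoszM coprimezE /=; apply: (@coprime_dvdl _ (X1 * Y1)).
    by rewrite E1 dvdn_mul // dvdn_exp.
  by rewrite coprimeMl cX1.
have EZ : D%:Z * a1%:Z * a2%:Z * Gm%:Z = X2%:Z * Y1%:Z * Gp%:Z by rewrite -!PoszM E.
have E1Z : X1%:Z * Y1%:Z = D%:Z * a1%:Z ^+ 2 by rewrite -PoszM E1; lia.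
have E2Z : X2%:Z * Y2%:Z = D%:Z * a2%:Z ^+ 2 by rewrite -PoszM E2; lia.
have cG' : coprimez c Gm by rewrite coprimez_sym coprimezE.
rewrite coprimez_sym in cDa.
case: dG => dG.
  exists D%:Z, a1%:Z, a2%:Z; split=> //.
  rewrite -(Gauss_dvdzr _ cDa) -(Gauss_dvdzr _ cG').
  have -> : Gm%:Z * (D%:Z * a1%:Z * (X1%:Z * a2%:Z - X2%:Z * a1%:Z)) =
     X1%:Z * (D%:Z * a1%:Z * a2%:Z * Gm%:Z) - X2%:Z * Gm%:Z * (D%:Z * a1%:Z ^+ 2) by ring.
  rewrite EZ -E1Z (_ : _ - _ = X1%:Z * X2%:Z * Y1%:Z * (Gp%:Z - Gm%:Z)); last by ring.
  exact: dvdz_mull.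
exists D%:Z, (- a1%:Z), a2%:Z; split=> //; first by rewrite sqrrN.
rewrite -(Gauss_dvdzr _ cDa) -(Gauss_dvdzr _ cG').
have -> : Gm%:Z * (D%:Z * a1%:Z * (X1%:Z * a2%:Z - X2%:Z * - a1%:Z)) =
   X1%:Z * (D%:Z * a1%:Z * a2%:Z * Gm%:Z) + X2%:Z * Gm%:Z * (D%:Z * a1%:Z ^+ 2) by ring.
rewrite EZ -E1Z (_ : _ + _ = X1%:Z * X2%:Z * Y1%:Z * (Gp%:Z + Gm%:Z)); last by ring.
exact: dvdz_mull.
Qed.

Lemma primitive_of_solution X Y z (D s : int) : solution c P X Y z ->
  X%:Z * Y%:Z = D * s ^+ 2 ->
  primitive c%:Z z ((X%:Z - Y%:Z, 2 * s) : quad D).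
Proof.
move=> S XYE; have z0 := solution_exp_gt0 S; have oXY := solution_odd S.
case: S => /andP[X0 XY] sm cX _.
have smZ : X%:Z + Y%:Z = c%:Z ^+ z by rewrite -PoszD sm -natz natrX natz.
split=> /=.
- rewrite /qnorm /= mulnC exprM -smZ.
  transitivity ((X%:Z - Y%:Z) ^+ 2 + 4 * (D * s ^+ 2)); first by ring.
  by rewrite -XYE; ring.
- rewrite (@coprimez_modl _ (2 * X%:Z)); last first.
    rewrite (_ : _ - _ = - (X%:Z + Y%:Z)); last by ring.
    by rewrite rpredN smZ dvdz_expr_self.
  by rewrite coprimezMl !coprimezE /= cX prime_coprime // dvdn2 c_odd.
- by rewrite dvdzE; lia.
- exact: dvdz_mulr.
Qed.

End Pair.

(** The norm of z is the square of c^g, so c^g + z.1 and c^g - z.1 are 2X and 2Y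
    with 4 X Y = D z.2^2, and z = (sqrt X + sqrt(-Y))^2. *)
Lemma primitive_split (D c : int) g (z : quad D) : 0 < D -> 1 < c -> ~~ (2 %| c)%Z ->
    (0 < g)%N -> primitive c g z ->
  exists X Y : int, [/\ 0 < X, 0 < Y, X + Y = c ^+ g, coprimez X Y
    & forall t, (z ^+ t).1 = re X Y t].
Proof.
move=> D0 c1 oc g0 [nz cz oz /dvdzP[b bE]].
have cg0 : 0 < c ^+ g by rewrite exprn_gt0 // (lt_trans _ c1).
have ocg : ~~ (2 %| c ^+ g)%Z.
  by apply: contraNN oc => /(dvdzX_prime (isT : prime 2)).
(* X = (c^g + z.1) / 2 and Y = (c^g - z.1) / 2 *)
have [X XE] : exists X, c ^+ g = 2 * X - z.1.
  exists ((c ^+ g + z.1) %/ 2)%Z; move: ocg oz; rewrite !dvdzE; move: (c ^+ g) z.1 => *; lia.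
have [Y YE] : exists Y, Y = c ^+ g - X by exists (c ^+ g - X).
have zE : z.1 = X - Y by lia.
have sE : X + Y = c ^+ g by lia.
have XYE : X * Y = D * b ^+ 2.
  move: nz; rewrite /qnorm bE zE mulnC exprM -sE => e; apply: (@mulfI _ 4) => //.
  transitivity ((X + Y) ^+ 2 - (X - Y) ^+ 2); first by ring.
  by rewrite -e; ring.
have cX : coprimez X c.
  have : coprimez (2 * X) c.
    rewrite (@coprimez_modl _ z.1) //.
    by rewrite -XE dvdz_expr_self.
  by rewrite coprimezMl => /andP[].
have cXY : coprimez X Y.
  have h : coprimez (c ^+ g) X by rewrite coprimezXl // coprimez_sym.
  move: h; rewrite (@coprimez_modl _ Y) 1?coprimez_sym //.
  by rewrite -sE addrK.
have b0 : b != 0.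
  apply/eqP => b0; move: nz; rewrite /qnorm bE b0 mul0r expr0n mulr0 addr0 => e.
  have : (c %| 1)%Z.
    rewrite -(@Gauss_dvdzr _ (z.1 ^+ 2)) ?mulr1 ?e ?dvdz_expr_self ?muln_gt0 //.
    by rewrite -e coprimezXr // coprimez_sym.
  by rewrite dvdz1; lia.
have XY0 : 0 < X * Y by rewrite XYE mulr_gt0 // lt_neqAle eq_sym expf_neq0 // sqr_ge0.
have [X0 Y0] : 0 < X /\ 0 < Y.
  have [X0|X0] := ltP 0 X; first by rewrite pmulr_rgt0 in XY0.
  have Y0 : 0 <= Y by lia.
  by have := mulr_le0_ge0 X0 Y0; rewrite leNgt XY0.
exists X, Y; split=> // t.
have -> : z = scale D b (binom_sq X Y).
  by rewrite [LHS]surjective_pairing /scale /= zE bE mulrC.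
by rewrite -(scaleX XYE).
Qed.

(** The indices t with p dividing im t are closed under subtraction, so they would
    contain gcd s t = 1, but im 1 = 2. *)
Lemma im_coprime_index (X Y : int) (p s t : nat) : prime p ->
  (p%:Z %| X + Y)%Z = false ->
  coprime s t -> (p%:Z %| im X Y s)%Z -> (p%:Z %| im X Y t)%Z -> p = 2%N.
Proof.
move=> pp nS; have [n] := ubnP (s + t)%N; elim: n s t => // n IH s t.
wlog st : s t / (s <= t)%N.
  move=> H; have [|/ltnW ts] := leqP s t; first exact: H.
  by move=> le cst ps pt; apply: (H t s) => //; rewrite 1?addnC // coprime_sym.
rewrite ltnS => le cst ps pt.
case: (posnP s) => [s0|s0].
  move: cst pt; rewrite s0 /coprime gcd0n => /eqP->; rewrite im1 dvdzE /=.
  by rewrite dvdn_prime2 // => /eqP.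
apply: (IH s (t - s)%N) => //; first by lia.
  by move: cst; rewrite /coprime -{1}(subnKC st) gcdnDl.
move: pt; rewrite -{1}(subnKC st) imD => pt.
have : (p%:Z %| re X Y s * im X Y (t - s))%Z.
  rewrite (_ : _ * _ = re X Y s * im X Y (t - s) + re X Y (t - s) * im X Y s -
     re X Y (t - s) * im X Y s); last by ring.
  by apply: rpredB => //; apply: dvdz_mull.
rewrite dvdzM_prime // => /orP[pr|//]; exfalso.
have : (p%:Z %| (X + Y) ^+ (2 * s))%Z.
  by rewrite -norm_re_im; apply: rpredD; rewrite expr2; apply: dvdz_mull => //; apply: dvdz_mull.
by move/(dvdzX_prime pp); rewrite nS.
Qed.

Lemma even_of_odd_sum (X Y : int) : ~~ (2 %| X + Y)%Z -> (2 %| X)%Z || (2 %| Y)%Z.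
Proof. by move=> h; apply/orP; move: h; lia. Qed.

Section Pair.
Variables (c : nat) (P : pred nat).
Hypotheses (c_gt1 : (1 < c)%N) (c_odd : odd c).

(** A prime dividing im s divides X1 Y1, hence X2 Y2 because the solutions have the
    same primes, hence X Y or im t; coprimality of s and t excludes im t. *)
Lemma im_supported_of_solutions (X Y : int) g X1 Y1 s X2 Y2 t :
    (0 < g)%N -> X + Y = c%:Z ^+ g -> coprimez X Y -> coprime s t ->
    solution c P X1 Y1 (g * s) -> solution c P X2 Y2 (g * t) ->
    X1%:Z - Y1%:Z = re X Y s \/ X1%:Z - Y1%:Z = - re X Y s ->
    X2%:Z - Y2%:Z = re X Y t \/ X2%:Z - Y2%:Z = - re X Y t ->
  im_supported X Y s.
Proof.
move=> g0 sE cXY cst S1 S2 E1 E2 p pp ps.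
have prod4 X' Y' u : solution c P X' Y' (g * u) ->
    X'%:Z - Y'%:Z = re X Y u \/ X'%:Z - Y'%:Z = - re X Y u ->
    4 * (X'%:Z * Y'%:Z) = X * Y * im X Y u ^+ 2.
  case=> _ s' _ _ e; have e2 : (X'%:Z - Y'%:Z) ^+ 2 = re X Y u ^+ 2.
    by case: e => ->; rewrite ?sqrrN.
  have s2 : (X'%:Z + Y'%:Z) ^+ 2 = (X + Y) ^+ (2 * u).
    by rewrite -PoszD s' sE -exprM -natz natrX natz -exprM; congr (_ ^+ _); lia.
  transitivity ((X'%:Z + Y'%:Z) ^+ 2 - (X'%:Z - Y'%:Z) ^+ 2); first by ring.
  by rewrite s2 e2 -norm_re_im; ring.
have F1 := prod4 _ _ _ S1 E1; have F2 := prod4 _ _ _ S2 E2.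
apply/negPn/negP => nXY.
have even_XY : (2 %| X * Y)%Z.
  have : ~~ (2 %| X + Y)%Z.
    by rewrite sE; apply/negP => /(dvdzX_prime (isT : prime 2)); rewrite dvdzE dvdn2 c_odd.
  by rewrite (@dvdzM_prime 2) //; apply: even_of_odd_sum.
have p2 : p <> 2%N by move=> p2; rewrite p2 even_XY in nXY.
have np4 : (p%:Z %| 4)%Z = false.
  apply/negP; rewrite (_ : 4 = 2 ^+ 2 :> int) // => /(dvdzX_prime pp).
  by rewrite dvdzE /= dvdn_prime2 // => /eqP.
have p1 : (p %| X1 * Y1)%N.
  have : (p%:Z %| 4 * (X1%:Z * Y1%:Z))%Z by rewrite F1 expr2; apply: dvdz_mull; apply: dvdz_mull.
  by rewrite dvdzM_prime // np4 -PoszM dvdzE.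
have p2' : (p %| X2 * Y2)%N.
  by case: S2 => _ _ _ ->//; case: S1 => _ _ _ <-.
have pt : (p%:Z %| im X Y t)%Z.
  have : (p%:Z %| X * Y * im X Y t ^+ 2)%Z by rewrite -F2 -PoszM; apply: dvdz_mull; rewrite dvdzE.
  by rewrite dvdzM_prime // (negPf nXY) => /(dvdzX_prime pp).
(* an odd prime foreign to X Y cannot divide both imaginary parts *)
apply: p2; apply: (im_coprime_index pp _ cst ps pt).
apply/negP; rewrite sE => /(dvdzX_prime pp); rewrite dvdzE /= => pc.
have z0 := solution_exp_gt0 c_gt1 c_odd S1; case: S1 => _ s1 cX _.
have [cY _] := coprime_sum_pow z0 s1 cX.
have := coprimeMl c X1 Y1; rewrite cX cY => /eqP h.
have : (p %| gcdn (X1 * Y1) c)%N by rewrite dvdn_gcd p1.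
by rewrite h dvdn1; case: eqP pp => // ->.
Qed.

Lemma linked_base X1 Y1 z1 X2 Y2 z2 :
    solution c P X1 Y1 z1 -> solution c P X2 Y2 z2 -> linked c X1 Y1 X2 Y2 ->
  exists (X Y : int) g s t,
    [/\ [/\ 0 < X, 0 < Y, X + Y = c%:Z ^+ g, 3 <= X + Y & coprimez X Y],
        [/\ (0 < g)%N, z1 = (g * s)%N, z2 = (g * t)%N & coprime s t],
        X1%:Z - Y1%:Z = re X Y s \/ X1%:Z - Y1%:Z = - re X Y s,
        X2%:Z - Y2%:Z = re X Y t \/ X2%:Z - Y2%:Z = - re X Y t
      & im_supported X Y s /\ im_supported X Y t].
Proof.
move=> S1 S2 L.
have [D [s1 [s2 [D0 E1 E2 dir]]]] := codirected_of_linked c_gt1 c_odd S1 S2 L.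
have z10 := solution_exp_gt0 c_gt1 c_odd S1; have z20 := solution_exp_gt0 c_gt1 c_odd S2.
have p1 := primitive_of_solution c_gt1 c_odd S1 E1.
have p2 := primitive_of_solution c_gt1 c_odd S2 E2.
have cZ : 1 < c%:Z by [].
have oZ : ~~ (2 %| c%:Z)%Z by rewrite dvdzE dvdn2 c_odd.
have dir' : codirected c%:Z ((X1%:Z - Y1%:Z, 2 * s1) : quad D) (X2%:Z - Y2%:Z, 2 * s2).
  have sm X Y z : solution c P X Y z -> (0 < z)%N -> (c%:Z %| X%:Z + Y%:Z)%Z.
    by case=> _ s _ _ z0; rewrite -PoszD s dvdzE dvdn_exp.
  rewrite /codirected /=.
  rewrite (_ : _ - _ = 4 * (X1%:Z * s2 - X2%:Z * s1) - 2 * s2 * (X1%:Z + Y1%:Z)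
      + 2 * s1 * (X2%:Z + Y2%:Z)); last by ring.
  apply: rpredD; last by apply: dvdz_mull; apply: sm S2 z20.
  by apply: rpredB; apply: dvdz_mull => //; apply: sm S1 z10.
have [g [z [s [t [pz cst [z1E z2E] H1 H2]]]]] := common_base D0 cZ oZ z10 z20 p1 p2 dir'.
have g0 : (0 < g)%N by move: z10; rewrite z1E muln_gt0 => /andP[].
have [X [Y [X0 Y0 sE cXY reE]]] := primitive_split D0 cZ oZ g0 pz.
have R1 : X1%:Z - Y1%:Z = re X Y s \/ X1%:Z - Y1%:Z = - re X Y s.
  by case: H1 => /(congr1 fst) /= ->; rewrite ?reE; [left|right; rewrite -reE].
have R2 : X2%:Z - Y2%:Z = re X Y t \/ X2%:Z - Y2%:Z = - re X Y t.
  by case: H2 => /(congr1 fst) /= ->; rewrite ?reE; [left|right; rewrite -reE].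
rewrite z1E in S1; rewrite z2E in S2.
have G1 := im_supported_of_solutions g0 sE cXY cst S1 S2 R1 R2.
rewrite coprime_sym in cst; have G2 := im_supported_of_solutions g0 sE cXY cst S2 S1 R2 R1.
exists X, Y, g, s, t; split=> //; split=> //; last by rewrite coprime_sym.
have : (3 <= c ^ g)%N.
  have c3 : (3 <= c)%N by case: (c) c_gt1 c_odd => [|[|[|]]].
  by apply: leq_trans c3 _; rewrite -{1}[c]expn1 leq_pexp2l // ltnW.
by rewrite sE -lez_nat -[(c ^ g)%N%:Z]natz natrX natz.
Qed.
End Pair.

(** As X2 + Y2 = c^z2, the number Y2 is determined. *)
Definition doubling (X1 Y1 z1 X2 z2 : nat) :=
  [/\ Y1 = X1.+1, z2 = (2 * z1)%N & X2 = 1%N].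

(** Here Y2 = 3u (24u + 3)^2 = 3^(4m+3) u. *)
Definition tripling (X1 Y1 z1 X2 z2 : nat) := exists m u : nat,
  [/\ (0 < m)%N, (8 * u + 1 = 9 ^ m)%N, X1 = (3 * u)%N /\ Y1 = (9 * u + 1)%N,
      z2 = (3 * z1)%N & X2 = Y1].

Lemma lt_mul_sqr (x y a : int) : 0 < x -> y < 9 * x -> a <= -3 \/ 3 <= a ->
  y < x * a ^+ 2.
Proof.
move=> x0 yx a3; have a9 : 9 <= a ^+ 2 by nia.
by apply: lt_le_trans yx _; rewrite mulrC ler_pM2l.
Qed.

Section Pair.
Variables (c : nat) (P : pred nat).
Hypotheses (c_gt1 : (1 < c)%N) (c_odd : odd c).

(** By [im_supported_index] the exponents are s = 1 and t = 1, 2 or 3; the base is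
    then the first solution, up to the order of X and Y, and the second one is
    its square or its cube. *)
Lemma linked_pair X1 Y1 z1 X2 Y2 z2 : (z1 <= z2)%N ->
    solution c P X1 Y1 z1 -> solution c P X2 Y2 z2 -> linked c X1 Y1 X2 Y2 ->
  [\/ [/\ X1 = X2, Y1 = Y2 & z1 = z2], doubling X1 Y1 z1 X2 z2
    | tripling X1 Y1 z1 X2 z2].
Proof.
move=> z12 S1 S2 L.
have [X [Y [g [s [t [[X0 Y0 sE s3 cXY] [g0 z1E z2E cst] R1 R2 [G1 G2]]]]]]] :=
  linked_base c_gt1 c_odd S1 S2 L.
have s0 : (0 < s)%N.
  by move: (solution_exp_gt0 c_gt1 c_odd S1); rewrite z1E muln_gt0 => /andP[].
have t0 : (0 < t)%N.
  by move: (solution_exp_gt0 c_gt1 c_odd S2); rewrite z2E muln_gt0 => /andP[].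
have st : (s <= t)%N by move: z12; rewrite z1E z2E leq_pmul2l.
have sum u X' Y' : solution c P X' Y' (g * u) -> (X' < Y')%N /\ X'%:Z + Y'%:Z = (X + Y) ^+ u.
  by case=> /andP[_ ->] s' _ _; rewrite -PoszD s' sE -exprM -[(c ^ _)%N%:Z]natz natrX natz.
rewrite z1E in S1; rewrite z2E in S2.
have [lt1 sum1] := sum _ _ _ S1; have [lt2 sum2] := sum _ _ _ S2.
have v2 : re X Y 2 = (X - Y) ^+ 2 - 4 * (X * Y).
  by rewrite (@re_double X Y 1) re1 im1; ring.
have v3 : re X Y 3 = X * (X - 3 * Y) ^+ 2 - Y * (3 * X - Y) ^+ 2.
  by rewrite (@re_odd X Y 1) /cofX /cofY re1 im1; ring.
have e3 : (X + Y) ^+ 3 = X * (X - 3 * Y) ^+ 2 + Y * (3 * X - Y) ^+ 2 by ring.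
have e2 : (X + Y) ^+ 2 = (X - Y) ^+ 2 + 4 * (X * Y) by ring.
case: (im_supported_index X0 Y0 s3 cXY s0 G1) => [sE1|[sE1 d1]|[sE1 tr1]];
case: (im_supported_index X0 Y0 s3 cXY t0 G2) => [tE|[tE d2]|[tE tr2]];
  rewrite sE1 tE // in st cst z1E z2E R1 R2 sum1 sum2; try by [].
- rewrite re1 in R1 R2; rewrite expr1 in sum1 sum2.
  by constructor 1; split; [lia|lia|rewrite z1E z2E].
- rewrite re1 v2 in R1 R2; rewrite expr1 e2 in sum1 sum2.
  constructor 2; split; [lia|lia|].
  have q1 : (X - Y) ^+ 2 = 1 by case: d2 => ->.
  by rewrite q1 in R2 sum2; lia.
- rewrite re1 v3 in R1 R2; rewrite expr1 e3 in sum1 sum2; constructor 3.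
  have m9 m : (0 < m)%N -> (9 <= 9 ^ m)%N by move=> m0; rewrite -{1}[9%N]expn1 leq_pexp2l.
  case: tr2 => -[m [u [m0 uE XE YE]]]; exists m, u; have := m9 m m0; rewrite -uE => u1.
    have q1 : (3 * X - Y) ^+ 2 = 1 by rewrite (_ : _ - _ = -1) //; clear -XE YE; lia.
    rewrite q1 mulr1 in R2 sum2.
    have big : Y < X * (X - 3 * Y) ^+ 2 by apply: lt_mul_sqr => //; clear -XE YE u1; lia.
    move: (X * _) R2 sum2 big => N R2 sum2 big.
    clear -XE YE R1 R2 sum1 sum2 big lt1 lt2 m0 uE z1E z2E.
    by split=> //; lia.
  have q1 : (X - 3 * Y) ^+ 2 = 1 by rewrite (_ : _ - _ = 1) //; clear -XE YE; lia.
  rewrite q1 mulr1 in R2 sum2.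
  have big : X < Y * (3 * X - Y) ^+ 2 by apply: lt_mul_sqr => //; clear -XE YE u1; lia.
  move: (Y * _) R2 sum2 big => N R2 sum2 big.
  clear -XE YE R1 R2 sum1 sum2 big lt1 lt2 m0 uE z1E z2E.
  by split=> //; lia.
- by exfalso; case: d1 => d1; case: tr2 => -[m [[|u] [m0 uE XE YE]]]; lia.
Qed.
End Pair.

(** * Powers y^a - 1 with the same prime divisors *)

Local Open Scope nat_scope.

(** Binomial expansion of the powers of x + 1. *)
Lemma geometric_sum_mod x n : exists r,
  (\sum_(i < n) x.+1 ^ i = n + 'C(n, 2) * x + x ^ 2 * r)%N.
Proof.
have pw i : exists r, (x.+1 ^ i = 1 + i * x + x ^ 2 * r)%N.
  elim: i => [|i [r IH]]; first by exists 0%N; rewrite expn0; lia.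
  by exists (i + r + x * r)%N; rewrite expnS IH; lia.
elim: n => [|n [r IH]]; first by exists 0%N; rewrite big_ord0 bin0n; lia.
have [s E] := pw n; exists (r + s)%N.
by rewrite big_ord_recr /= IH E binS bin1; lia.
Qed.

(** A prime dividing S = 1 + y + ... + y^(q-1) divides y - 1, hence q, as S = q modulo
    y - 1.  So S is a power of q, and for odd q it is not divisible by q^2, while
    S > q. *)
Lemma primes_pow_pred y q : prime q -> (1 < y)%N ->
    (forall p, prime p -> (p %| (y ^ q).-1)%N -> (p %| y.-1)%N) ->
  q = 2%N /\ exists i, y.+1 = (2 ^ i)%N.
Proof.
move=> pq y1 H; set S := (\sum_(i < q) y ^ i)%N.
have SE : (y ^ q).-1 = (y.-1 * S)%N by rewrite predn_exp.
have [x xE] : exists x, y = x.+1 by exists y.-1; lia.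
have [r rE] := geometric_sum_mod x q; rewrite -xE -/S in rE.
have pS p : prime p -> (p %| S)%N -> p = q /\ (q %| x)%N.
  move=> pp pS; have px : (p %| x)%N.
    by have := H p pp; rewrite SE xE /=; apply; rewrite dvdn_mull.
  suff pqE : p = q by rewrite -pqE.
  apply/eqP; rewrite -dvdn_prime2 //; move: pS.
  rewrite rE -addnA dvdn_addl //; apply: dvdn_add; first by rewrite dvdn_mull.
  by rewrite -mulnn -mulnA dvdn_mulr.
have S0 : (q < S)%N.
  have q1 := prime_gt1 pq; rewrite rE.
  have : (0 < 'C(q, 2) * x)%N by rewrite muln_gt0 bin_gt0 q1; lia.
  by lia.
have [i iE] : exists i, S = (q ^ i)%N.
  have S1 : (0 < S)%N by lia.
  suff /p_natP [i ->] : q.-nat S by exists i.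
  by apply/pnatP => // p pp /(pS p pp)[-> _]; rewrite inE.
have [q2|oq] := even_prime pq.
  split=> //; exists i; rewrite -[in RHS]q2 -iE /S q2.
  by rewrite !big_ord_recr big_ord0 /= expn0 expn1; lia.
exfalso; have i1 : (1 < i)%N.
  by move: S0; rewrite iE -{1}[q]expn1 ltn_exp2l // prime_gt1.
(* S > q forces q^2 to divide S, but S = q modulo q^2 *)
have qS2 : (q ^ 2 %| S)%N by rewrite iE dvdn_exp2l.
have qx : (q %| x)%N by apply: (pS q pq _).2; apply: dvdn_trans qS2; rewrite dvdn_exp.
have q3 : (2 < q)%N by case: q pq oq {pS SE S rE S0 iE i1 qS2 qx H} => [|[|[|]]].
have : (q ^ 2 %| q)%N.
  move: qS2; rewrite rE -addnA dvdn_addl //; apply: dvdn_add.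
    by rewrite -mulnn dvdn_mul // prime_dvd_bin.
  by rewrite dvdn_mulr // dvdn_exp2r.
move/(dvdn_leq (prime_gt0 pq)); rewrite leqNgt -{1}[q]expn1 ltn_exp2l ?prime_gt1 //.
Qed.

Lemma dvd_pow_pred_gcd p y a b : (0 < y)%N ->
  (p %| (y ^ a).-1)%N -> (p %| (y ^ b).-1)%N -> (p %| (y ^ gcdn a b).-1)%N.
Proof.
move=> y0; have [n] := ubnP (a + b)%N; elim: n a b => // n IH a b.
wlog ab : a b / (a <= b)%N.
  move=> H; have [|/ltnW ba] := leqP a b; first exact: H.
  by move=> le pa pb; rewrite gcdnC; apply: H => //; rewrite addnC.
rewrite ltnS => le pa pb; case: (posnP a) => [a0|a0]; first by rewrite a0 gcd0n.
rewrite -(subnKC ab) gcdnDl; apply: IH => //; first by lia.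
move: pb; rewrite -{1}(subnKC ab) expnD.
have ya : (0 < y ^ a)%N by rewrite expn_gt0 y0.
have yb : (0 < y ^ (b - a))%N by rewrite expn_gt0 y0.
have -> : (y ^ a * y ^ (b - a)).-1 = ((y ^ a).-1 * y ^ (b - a) + (y ^ (b - a)).-1)%N.
  by move: (y ^ a)%N (y ^ (b - a))%N ya yb => [//|u] [//|v] _ _ /=; lia.
by rewrite dvdn_addr // dvdn_mulr.
Qed.

Lemma dvd_pow_pred p y a b : (a %| b)%N -> (p %| (y ^ a).-1)%N -> (p %| (y ^ b).-1)%N.
Proof.
move=> /dvdnP[k ->] pa; rewrite mulnC expnM; apply: dvdn_trans pa _.
by rewrite [X in (_ %| X)%N]predn_exp dvdn_mulr.
Qed.

(** A substitute for primitive divisors: with g = gcd a b, all primes of y^b - 1 divide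
    y^g - 1, and [primes_pow_pred] then leaves only b = g.  The hypothesis on y
    or on the parities excludes cases such as 3^2 - 1 and 3 - 1. *)
Lemma same_primes_pow_pred y a b : (1 < y)%N -> (0 < a)%N -> (0 < b)%N ->
    (y %% 4 = 1)%N \/ odd a /\ odd b ->
    (forall p, prime p -> (p %| (y ^ a).-1)%N = (p %| (y ^ b).-1)%N) -> a = b.
Proof.
move=> y1; have y0 := ltnW y1.
suff half u v : (0 < u)%N -> (0 < v)%N -> (y %% 4 = 1)%N \/ odd u /\ odd v ->
    (forall p, prime p -> (p %| (y ^ u).-1)%N = (p %| (y ^ v).-1)%N) -> (v %| u)%N.
  move=> a0 b0 h H; apply/eqP; rewrite eqn_dvd; apply/andP; split; apply: half => //.
    by case: h => [|[]]; [left|right].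
  by move=> p pp; rewrite H.
move=> u0 v0 h H; set g := gcdn u v.
have g0 : (0 < g)%N by rewrite gcdn_gt0 u0.
have [k kE] := dvdnP (dvdn_gcdr u v : g %| v)%N.
have [k1|k1] := leqP k 1.
  have -> : v = g by move: v0; rewrite kE; case: k k1 {kE} => [|[|]] //; rewrite mul1n.
  exact: dvdn_gcdl.
exfalso; have pq := pdiv_prime k1; move: (pdiv_dvd k) pq; move: (pdiv k) => q /dvdnP[l lE] pq.
have yg1 : (1 < y ^ g)%N by rewrite -(exp1n g) ltn_exp2r.
have [|q2 [i iE]] := primes_pow_pred pq yg1.
  move=> p pp; rewrite -expnM => pg; apply: dvd_pow_pred_gcd => //.
    by rewrite H //; apply: dvd_pow_pred pg; rewrite kE lE -mulnA [(q * g)%N]mulnC dvdn_mull.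
  by apply: dvd_pow_pred pg; rewrite kE lE -mulnA [(q * g)%N]mulnC dvdn_mull.
(* here y^g + 1 is a power of 2; it is 2 modulo 4 if y = 1 modulo 4 *)
case: h => [y4|[_ ov]]; last by move: ov; rewrite kE lE q2 !oddM andbF.
have g4 : (y ^ g %% 4 = 1)%N by rewrite -modnXm y4 exp1n.
by case: i iE => [|[|i]]; rewrite ?expnS; lia.
Qed.

(** * The equation 2 y^2 + 1 = 3^(2m+1) *)

Local Open Scope ring_scope.

(** Normal form of (1 + sqrt(-2))^(8l) for l > 0: replacing l by 2l doubles N and keeps
    a and b modulo 4. *)
Definition step4 (l : nat) (N a b e : int) :=
  [/\ re 1 2 (4 * l) = 1 + 2 * N * a, im 1 2 (4 * l) = N * b,
      a - b = 4 * e + 2 & (8 %| N)%Z /\ N != 0].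

Lemma re_im_4 : re 1 2 4 = 17 /\ im 1 2 4 = 56. Proof. by []. Qed.
Lemma re_im_8 : exists p q : int,
  re 1 2 8 = 1 + 16 * (4 * p + 2) /\ im 1 2 8 = 8 * (4 * q + 2).
Proof.
have [r4 i4] := re_im_4; exists (-94), 59.
by rewrite (@re_double 1 2 4) (@im_double 1 2 4) r4 i4; split; lia.
Qed.

Lemma step4_odd i : exists a b e, step4 (2 * i).+1 8 a b e.
Proof.
elim: i => [|i [a [b [e [ru iu abe _]]]]].
  have [r4 i4] := re_im_4.
  by exists 1, 7, (-2); split; rewrite ?muln1 ?r4 ?i4 //; lia.
have [p' [q' [r8 i8]]] := re_im_8.
have -> : (2 * i.+1).+1 = ((2 * i).+1 + 2)%N by lia.
pose p := 4 * p' + 2; pose q := 4 * q' + 2.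
exists (a + p + 16 * a * p - 8 * b * q), (b + q + 16 * a * q + 16 * p * b).
exists (e + (p' - q') + 4 * a * p - 2 * b * q - 4 * a * q - 4 * p * b).
rewrite /step4 mulnDr reD imD ru iu r8 i8 /p /q.
split; [ring | ring | | exact: (conj (dvdzz 8) isT)].
have -> : a = b + (4 * e + 2) by rewrite -abe; ring.
by ring.
Qed.

Lemma step4_exists l : (0 < l)%N -> exists N a b e, step4 l N a b e.
Proof.
have [n] := ubnP l; elim: n l => // n IH l; rewrite ltnS => ln l0.
case ol : (odd l).
  have [a [b [e h]]] := step4_odd l./2; exists 8, a, b, e.
  by rewrite (_ : l = (2 * l./2).+1) //; lia.
have lE : l = (2 * l./2)%N by lia.
have [||N [a [b [e [ru iu abe [/dvdzP[M NM] N0]]]]]] := IH l./2; [lia|lia|].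
(* squaring doubles N and changes a and b by multiples of 4 *)
exists (2 * N), (a + N * a ^+ 2 - 4 * M * b ^+ 2), (b + 2 * N * a * b).
exists (e + 2 * M * a ^+ 2 - M * b ^+ 2 - 4 * M * a * b).
rewrite {1}lE; split.
- by rewrite mulnCA re_double ru iu NM; ring.
- by rewrite mulnCA im_double ru iu; ring.
- by rewrite (_ : a = b + 4 * e + 2) ?NM; [ring | lia].
- by split; [rewrite dvdz_mull // NM dvdz_mull | rewrite mulf_neq0].
Qed.

(** cofX 1 2 m is the real part of (1 + sqrt(-2))^(2m+1).  It is 3 modulo 8 for odd
    m, while for m = 4l and m = 4l + 2, l > 0, it differs from 1 by a nonzero
    multiple of 16, by [step4_exists]. *)
Lemma cofX12_unit m : cofX 1 2 m = 1 \/ cofX 1 2 m = -1 -> m = 0%N \/ m = 2%N.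
Proof.
move=> h; rewrite (divn_eq m 4) in h *.
case: (posnP (m %/ 4)) => [l0|l0].
  rewrite l0 mul0n add0n in h *; have := ltn_pmod m (isT : 0 < 4)%N.
  case: (m %% 4)%N h => [|[|[|[|//]]]] h _; [by left | | by right |].
    by case: h.
  by case: h.
exfalso; have [N [a [b [e [ru iu abe [/dvdzP[M NM] N0]]]]]] := step4_exists l0.
move: h; rewrite mulnC; move: (m %/ 4)%N l0 ru iu => l l0 ru iu.
have reE r : re 1 2 (4 * l + r) = re 1 2 r + 2 * N * (a * re 1 2 r - b * im 1 2 r).
  by rewrite (reD 1 2 (4 * l) r) ru iu; ring.
have imE r : im 1 2 (4 * l + r) = im 1 2 r + N * (2 * a * im 1 2 r + b * re 1 2 r).
  by rewrite (imD 1 2 (4 * l) r) ru iu; ring.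
have aE : a = b + (4 * e + 2) by rewrite -abe; ring.
have M0 : M != 0 by apply: contra_neq N0 => M0; rewrite NM M0 mul0r.
(* 4f + 2 never vanishes, hence the value 1 is taken only for m = 0 and m = 2 *)
have nz f : M * (4 * f + 2) != 0 by rewrite mulf_neq0 //; lia.
have := ltn_pmod m (isT : 0 < 4)%N.
case: (m %% 4)%N => [|[|[|[|//]]]] _; rewrite /cofX reE imE NM aE.
- rewrite re0 im0 (_ : _ - _ = 1 + 16 * (M * (4 * e + 2))); last by ring.
  by move: (M * _) (nz e) => K K0; lia.
- rewrite re1 im1 (_ : _ - _ = - 5 + 16 * (M * (- 5 * (b + (4 * e + 2)) - b))); last by ring.
  by move: (M * _) => K; lia.
- have [-> ->] : re 1 2 2 = -7 /\ im 1 2 2 = -4 by [].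
  rewrite (_ : _ - _ = 1 + 16 * (M * (4 * (e + 3 * b) + 2))); last by ring.
  by move: (M * _) (nz (e + 3 * b)) => K K0; lia.
have [-> ->] : re 1 2 3 = 23 /\ im 1 2 3 = -10 by [].
rewrite (_ : _ - _ = 43 + 16 * (M * (43 * (b + (4 * e + 2)) - 13 * b))); last by ring.
by move: (M * _) => K; lia.
Qed.

(** Both (1 + sqrt(-2))^2 and (1 + w sqrt(-2))^2 have for norm a power of 9, and the
    congruence on w makes them codirected.  So the second is a power of the
    first up to sign, and its real part gives cofX = 1 or -1. *)
Lemma double_square_succ_pow3_int (w : int) m : (3 %| w - 1)%Z ->
  2 * w ^+ 2 + 1 = 3 ^+ (2 * m).+1 -> m = 0%N \/ m = 2%N.
Proof.
move=> w1 E.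
have px : primitive 3 1 (binom_sq 1 2) by split=> //; rewrite /qnorm.
have py : primitive 3 (2 * m).+1 ((1 - 2 * w ^+ 2, 2 * w) : quad (1 * 2)).
  split=> /=.
  - by rewrite mulnC exprM -E /qnorm /=; ring.
  - rewrite (@coprimez_modl _ 2) // (_ : _ - _ = - (2 * w ^+ 2 + 1)); last by ring.
    by rewrite rpredN E dvdz_expr_self.
  - by rewrite dvdzE; move: (w ^+ 2) => v; lia.
  - by rewrite dvdz_mulr.
have dxy : codirected 3 (binom_sq 1 2) ((1 - 2 * w ^+ 2, 2 * w) : quad (1 * 2)).
  rewrite /codirected /binom_sq /=; case/dvdzP: w1 => q wE.
  rewrite (_ : w = q * 3 + 1); last by rewrite -wE; ring.
  apply/dvdzP; exists (-2 * q + 4 * q * (q * 3 + 2)); ring.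
have [g [z [s [t [pz cst [sE tE] xE yE]]]]] :=
  common_base (isT : 0 < 1 * 2 :> int) (isT : 1 < 3 :> int) isT (isT : (0 < 1)%N)
    (ltn0Sn _) px py dxy.
have [g1 s1] : g = 1%N /\ s = 1%N.
  by move/esym/eqP: sE; rewrite muln_eq1 => /andP[/eqP-> /eqP->].
rewrite g1 mul1n in tE; rewrite s1 expr1 -tE in xE yE.
have zE : z ^+ (2 * m).+1 = binom_sq 1 2 ^+ (2 * m).+1 \/
    z ^+ (2 * m).+1 = - binom_sq 1 2 ^+ (2 * m).+1.
  case: xE => ->; first by left.
  by right; rewrite exprNn -signr_odd /= oddM /= expr1 mulN1r opprK.
have rE : 1 - 2 * w ^+ 2 = re 1 2 (2 * m).+1 \/ 1 - 2 * w ^+ 2 = - re 1 2 (2 * m).+1.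
  rewrite /re; case: yE => /(congr1 fst) /= ->; case: zE => -> /=; auto.
  by left; rewrite opprK.
rewrite re_odd in rE; have nE := norm_cofactors 1 2 m; rewrite [1 + 2]/(3 : int) -E in nE.
apply: cofX12_unit; case: rE => rE.
  have : cofX 1 2 m ^+ 2 = 1 by move: (_ ^+ 2) (cofY _ _ _ ^+ 2) (w ^+ 2) rE nE => a b v; lia.
  by move/eqP; rewrite sqrf_eq1 => /orP[/eqP|/eqP]; auto.
(* the other sign contradicts the parity of cofX, which is odd *)
exfalso; have : cofX 1 2 m ^+ 2 = 2 * w ^+ 2.
  by move: (_ ^+ 2) (cofY _ _ _ ^+ 2) (w ^+ 2) rE nE => a b v; lia.
have : ~~ (2 %| 2 * w ^+ 2 + 1)%Z by move: (w ^+ 2) => v; rewrite dvdzE; lia.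
rewrite -nE => o e; apply/negP: o; rewrite negbK mul1r e.
by rewrite -mulrDr dvdz_mulr.
Qed.

(** The sign of y is free, and one of y, -y is 1 modulo 3. *)
Lemma double_square_succ_pow3 (y m : nat) : (2 * y ^ 2 + 1 = 3 ^ (2 * m).+1)%N ->
  m = 0%N \/ m = 2%N.
Proof.
move=> E.
have EZ : 2 * y%:Z ^+ 2 + 1 = 3 ^+ (2 * m).+1.
  have -> : 3 ^+ (2 * m).+1 = (3 ^ (2 * m).+1)%N%:Z :> int by rewrite -[RHS]natz natrX.
  by rewrite -E; lia.
have y3 : ~~ (3 %| y)%N.
  apply/negP => /dvdnP[k yk]; move: E; rewrite [(3 ^ _)%N]expnS yk expnMn.
  move: (3 ^ (2 * m))%N (k ^ 2)%N => N v; lia.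
have [y1|y1] : (3 %| y%:Z - 1)%Z \/ (3 %| - y%:Z - 1)%Z by move: y3; clear; lia.
  exact: double_square_succ_pow3_int y1 EZ.
by apply: double_square_succ_pow3_int y1 _; rewrite sqrrN.
Qed.

(** * At most one solution is not the smallest of its class *)

Local Open Scope nat_scope.

Section Tops.
Variables (c : nat) (P : pred nat).
Hypotheses (c_gt1 : (1 < c)%N) (c_odd : odd c).

(** c^(2g) - 1 = 4 X (X + 1), and X (X + 1) is even. *)
Lemma prime_dvd_consecutive p X g : (X + X.+1 = c ^ g)%N -> prime p ->
  (p %| ((c ^ 2) ^ g).-1)%N = (p %| X * X.+1)%N.
Proof.
move=> s pp; have -> : ((c ^ 2) ^ g).-1 = (2 ^ 2 * (X * X.+1))%N.
  by rewrite -expnM mulnC expnM -s; lia.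
rewrite Euclid_dvdM //; case: (altP (p =P 2%N)) => [->|p2].
  have -> : (2 %| X * X.+1)%N by rewrite dvdn2 oddM /=; case: (odd X).
  by rewrite orbT.
by rewrite Euclid_dvdX // dvdn_prime2 // (negPf p2).
Qed.

Lemma doubling_unique X g X' h :
  solution c P X X.+1 g -> solution c P X' X'.+1 h -> g = h /\ X = X'.
Proof.
move=> S T; have g0 := solution_exp_gt0 c_gt1 c_odd S.
have h0 := solution_exp_gt0 c_gt1 c_odd T.
case: S T => _ s _ sP [_ t _ tP].
suff gh : g = h by split=> //; move: s t; rewrite gh; lia.
apply: (@same_primes_pow_pred (c ^ 2)) => //.
- by rewrite -(exp1n 2) ltn_exp2r.
- by left; rewrite -(odd_double_half c) c_odd; lia.
by move=> p pp; rewrite (prime_dvd_consecutive s pp) (prime_dvd_consecutive t pp) sP // tP.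
Qed.

Lemma pow3_of_tripling u m g : (8 * u + 1 = 9 ^ m)%N -> (3 * u + (9 * u + 1) = c ^ g)%N ->
  (3 ^ (2 * m).+1).-1 = (2 * c ^ g)%N.
Proof. by rewrite expnS expnM => <- <-; lia. Qed.

(** 2 c^g = 3^(2m+1) - 1, so the primes of 3^(2m+1) - 1 are 2 and those of c. *)
Lemma tripling_unique u m g u' m' h : (0 < g)%N -> (0 < h)%N ->
    (8 * u + 1 = 9 ^ m)%N -> (3 * u + (9 * u + 1) = c ^ g)%N ->
    (8 * u' + 1 = 9 ^ m')%N -> (3 * u' + (9 * u' + 1) = c ^ h)%N ->
  g = h /\ u = u'.
Proof.
move=> g0 h0 um s um' s'; have e := pow3_of_tripling um s; have e' := pow3_of_tripling um' s'.
have : (2 * m).+1 = (2 * m').+1.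
  apply: (@same_primes_pow_pred 3) => //; first by right; rewrite /= !oddM.
  by move=> p pp; rewrite e e' !Euclid_dvdM // !Euclid_dvdX // g0 h0.
move=> mm; have mE : m = m' by lia.
have uE : u = u' by rewrite mE in um; lia.
split=> //; apply/eqP; rewrite -(@eqn_exp2l c) // -s -s' uE; exact: eqxx.
Qed.

(** The doubling makes the primes of c^2 - 1 divide 3u (9u + 1).  For odd h this forces
    c + 1 to be a power of 2, while c^h = 12u + 1.  For even h, c^h is a square
    y^2 with 2 y^2 + 1 = 3^(2m+1), which leaves u = 10 and c = 11. *)
Lemma doubling_tripling_excl X g u m h : (0 < m)%N -> (8 * u + 1 = 9 ^ m)%N ->
  solution c P X X.+1 g -> solution c P (3 * u) (9 * u + 1) h -> False.
Proof.
move=> m0 um S T; have h0 := solution_exp_gt0 c_gt1 c_odd T.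
have g0 := solution_exp_gt0 c_gt1 c_odd S.
case: S T => _ s _ sP [_ t _ tP].
have transfer p : prime p -> (p %| ((c ^ 2) ^ g).-1)%N -> (p %| 3 * u * (9 * u + 1))%N.
  by move=> pp; rewrite (prime_dvd_consecutive s pp) sP // tP.
have [oh|eh] := boolP (odd h).
  (* modulo a prime divisor of c + 1, c^h = 12u + 1 is -1, so 3u and 9u + 1 are
     -1/2 *)
  have dvd_c1 : (c.+1 %| c ^ h + 1)%N.
    have hE : h = (2 * h./2).+1 by lia.
    have c2 : (c.+1 %| (c ^ 2).-1)%N by rewrite -subn1 -(exp1n 2) subn_sqr addn1 dvdn_mull.
    have ck : (c.+1 %| (c ^ (2 * h./2)).-1)%N.
      by apply: (@dvd_pow_pred _ _ 2) => //; rewrite dvdn_mulr.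
    have -> : (c ^ h + 1 = c * (c ^ (2 * h./2)).-1 + c.+1)%N.
      rewrite {1}hE expnS; have : (0 < c ^ (2 * h./2))%N by rewrite expn_gt0; lia.
      by case: (c ^ _)%N => // n _; rewrite /=; lia.
    by apply: dvdn_add => //; apply: dvdn_mull.
  have only2 p : prime p -> (p %| c.+1)%N -> p = 2%N.
    move=> pp pc; have : (p %| 3 * u * (9 * u + 1))%N.
      apply: transfer => //; apply: (@dvd_pow_pred _ (c ^ 2) 1); first exact: dvd1n.
      by rewrite expn1; apply: dvdn_trans pc _; rewrite -subn1 -(exp1n 2) subn_sqr addn1 dvdn_mull.
    have pt : (p %| 12 * u + 2)%N.
      by have := dvdn_trans pc dvd_c1; rewrite -t; congr (_ %| _)%N; lia.
    rewrite Euclid_dvdM // => /orP[] h'; apply/eqP; rewrite -dvdn_prime2 //.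
      have -> : 2 = (12 * u + 2 - 4 * (3 * u))%N by lia.
      by rewrite dvdn_sub // dvdn_mull.
    have -> : 2 = (3 * (12 * u + 2) - 4 * (9 * u + 1))%N by lia.
    by rewrite dvdn_sub // dvdn_mull.
  have [r rE] : exists r, c.+1 = (2 ^ r)%N.
    suff /p_natP [r ->] : 2.-nat c.+1 by exists r.
    by apply/pnatP => // p pp /(only2 p pp) ->.
  have c4 : (c %% 4 = 3)%N.
    by case: r rE => [|[|r]]; rewrite ?expnS ?expn0; lia.
  have : (c ^ h %% 4 = 3)%N.
    rewrite -modnXm c4 (_ : h = (2 * h./2).+1); last by lia.
    by rewrite expnS expnM -modnMmr -modnXm exp1n.
  by rewrite -t; lia.
have hE : h = (2 * h./2)%N by lia.
have sq : ((c ^ h./2) ^ 2 = c ^ h)%N by rewrite -expnM mulnC -hE.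
have [||m2] := @double_square_succ_pow3 (c ^ h./2) m.
- by rewrite sq -t expnS expnM -[(3 ^ 2)%N]/9%N -um; lia.
- by lia.
have u10 : u = 10%N by rewrite m2 in um; move: um; rewrite -[(9 ^ 2)%N]/81%N; lia.
have ck : (c ^ h./2 = 11)%N.
  by apply/eqP; rewrite -(@eqn_exp2r _ _ 2) // sq -t u10.
have c11 : c = 11%N.
  have : (c %| 11)%N by rewrite -ck dvdn_exp //; lia.
  by move/(primeP (isT : prime 11)).2 => /orP[/eqP c1|/eqP //]; have := c_gt1; rewrite c1.
(* 7 divides 9u + 1 = 91, and 11 has order 3 modulo 7 and 19 *)
have p7 : (7 %| ((c ^ 2) ^ g).-1)%N.
  by rewrite (prime_dvd_consecutive s) // sP // -tP // u10.
have g3 : (3 %| g)%N.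
  have pow7 b k : (b %% 7 = 2 -> (b ^ 3) ^ k %% 7 = 1)%N.
    by move=> b2; rewrite -modnXm -(modnXm 3 7 b) b2 exp1n.
  have N7 := pow7 (11 ^ 2)%N (g %/ 3) erefl.
  have gE : ((11 ^ 2) ^ g = ((11 ^ 2) ^ 3) ^ (g %/ 3) * (11 ^ 2) ^ (g %% 3))%N.
    by rewrite -(expnM (11 ^ 2) 3) -expnD [(3 * _)%N]mulnC -divn_eq.
  move: p7; rewrite c11 gE /dvdn; have := ltn_pmod g (isT : 0 < 3)%N.
  move: (((11 ^ 2) ^ 3) ^ (g %/ 3))%N N7 => N N7.
  case: (g %% 3)%N => [|[|[|]]] // _.
    by rewrite (_ : (11 ^ 2) ^ 1 = 121)%N //; lia.
  by rewrite (_ : (11 ^ 2) ^ 2 = 121 * 121)%N //; lia.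
have p19 : (19 %| ((c ^ 2) ^ g).-1)%N.
  apply: (@dvd_pow_pred _ _ 3) => //; rewrite c11; lia.
have := transfer 19 isT p19; by rewrite u10.
Qed.

(** The larger members of the exceptional pairs of [linked_pair]. *)
Definition is_top X2 Y2 z2 := exists X1 Y1 z1, [/\ (z1 < z2)%N,
  solution c P X1 Y1 z1, solution c P X2 Y2 z2 & linked c X1 Y1 X2 Y2].

Lemma top_unique X Y z X' Y' z' : is_top X Y z -> is_top X' Y' z' ->
  [/\ X = X', Y = Y' & z = z'].
Proof.
move=> [X1 [Y1 [z1 [lt S T L]]]] [X1' [Y1' [z1' [lt' S' T' L']]]].
have z10 := solution_exp_gt0 c_gt1 c_odd S; have z10' := solution_exp_gt0 c_gt1 c_odd S'.
suff [XX zz] : X = X' /\ z = z'.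
  by split=> //; case: T T' => _ t _ _ [_ t' _ _]; rewrite zz in t; lia.
case: (linked_pair c_gt1 c_odd (ltnW lt) S T L) =>
  [[_ _ zz]|[YE zE XE]|[m [u [m0 um [X1E YE] zE XE]]]].
- by rewrite zz ltnn in lt.
- case: (linked_pair c_gt1 c_odd (ltnW lt') S' T' L') =>
    [[_ _ zz]|[YE' zE' XE']|[m' [u' [m0' um' [X1E' YE'] zE' XE']]]].
  + by rewrite zz ltnn in lt'.
  + subst Y1 Y1'; have [e _] := doubling_unique S S'.
    by rewrite XE XE' zE zE' e.
  + by subst; have := doubling_tripling_excl m0' um' S S'.
- case: (linked_pair c_gt1 c_odd (ltnW lt') S' T' L') =>
    [[_ _ zz]|[YE' zE' XE']|[m' [u' [m0' um' [X1E' YE'] zE' XE']]]].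
  + by rewrite zz ltnn in lt'.
  + by subst; have := doubling_tripling_excl m0 um S' S.
  + subst X1 Y1 X1' Y1'; case: (S) => _ s _ _; case: (S') => _ s' _ _.
    have [e eu] := tripling_unique z10 z10' um s um' s'.
    by rewrite XE XE' zE zE' e eu.
Qed.

Lemma linked_eq_or_top X Y z X' Y' z' :
    solution c P X Y z -> solution c P X' Y' z' -> linked c X Y X' Y' ->
    linked c X' Y' X Y ->
  [\/ [/\ X = X', Y = Y' & z = z'], is_top X Y z | is_top X' Y' z'].
Proof.
move=> S S' L L'; case: (ltngtP z z') => [lt|lt|zz].
- by constructor 3; exists X, Y, z.
- by constructor 2; exists X', Y', z'.
have le : (z <= z')%N by rewrite zz.
case: (linked_pair c_gt1 c_odd le S S' L) => [h|[_ zE _]|[m [u [_ _ _ zE _]]]].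
- by constructor 1.
- by have := solution_exp_gt0 c_gt1 c_odd S; lia.
by have := solution_exp_gt0 c_gt1 c_odd S; lia.
Qed.
End Tops.

(** * Counting the classes of a lattice modulo its double *)

Local Open Scope ring_scope.

Lemma ffun_intmulE (aT : finType) (f : {ffun aT -> int}) (k : int) i :
  (f *~ k) i = f i * k.
Proof.
rewrite -mulrzz; case: k => k; first by rewrite -!pmulrn ffunMnE.
by rewrite !NegzE !mulrNz ffunE -!pmulrn ffunMnE.
Qed.

Section Lattice.
Variables (n : nat) (M : {ffun 'I_n -> int} -> Prop).
Hypotheses (M0 : M 0) (MB : forall f g, M f -> M g -> M (f - g)).
Implicit Types f g : {ffun 'I_n -> int}.

Lemma latticeN f : M f -> M (- f).
Proof. by move=> Mf; rewrite -sub0r; apply: MB. Qed.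

Lemma latticeD f g : M f -> M g -> M (f + g).
Proof. by move=> Mf Mg; rewrite -[g]opprK; apply: MB => //; apply: latticeN. Qed.

Lemma latticeMn f k : M f -> M (f *+ k).
Proof. by move=> Mf; elim: k => [|k IH]; rewrite ?mulr0n // mulrS; apply: latticeD. Qed.

Lemma latticeMz f (k : int) : M f -> M (f *~ k).
Proof.
by move=> Mf; case: k => k; [apply: latticeMn | apply: latticeN; apply: latticeMn].
Qed.

Definition double_congruent f g := exists h, M h /\ f - g = h *+ 2.

Lemma double_congruent_refl f : double_congruent f f.
Proof. by exists 0; rewrite subrr mul0rn. Qed.

Lemma double_congruent_sym f g : double_congruent f g -> double_congruent g f.
Proof.
by case=> h [Mh e]; exists (- h); split; [apply: latticeN | rewrite mulNrn -e opprB].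
Qed.

Definition vanishes_from k f := forall i : 'I_n, (k <= i)%N -> f i = 0.

(** By induction on the number k of coordinates: after subtracting a multiple of a
    vector b of M whose last coordinate is minimal positive, k - 1 coordinates
    are left, and only the parity of the multiple matters modulo 2M. *)
Lemma lattice_code k : (k <= n)%N -> exists code : {ffun 'I_n -> int} -> nat,
  (forall f, code f < 2 ^ k)%N /\
  (forall f g, M f -> M g -> vanishes_from k f -> vanishes_from k g ->
     code f = code g -> double_congruent f g).
Proof.
elim: k => [|k IH] kn.
  exists (fun=> 0%N); split=> // f g _ _ f0 g0 _.
  have -> : f = g by apply/ffunP => i; rewrite f0 // g0.
  exact: double_congruent_refl.
have [code [code_lt codeP]] := IH (ltnW kn).
pose i0 := Ordinal kn.
have lower f : vanishes_from k.+1 f -> f i0 = 0 -> vanishes_from k f.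
  move=> fv f0 i; rewrite leq_eqVlt => /orP[/eqP ki|]; last exact: fv.
  by rewrite -f0; congr (f _); apply: val_inj.
(* the values at i0 of the vectors of M form the multiples of the least positive
   one, b i0, if there is a nonzero value at all *)
pose hit m := `[< exists f, [/\ M f, vanishes_from k.+1 f & f i0 = m.+1%:Z] >].
have [[m0 hm0]|nohit] := pselect (exists m, hit m); last first.
  exists code; split=> [f|f g Mf Mg fv gv].
    by rewrite (ltn_trans (code_lt f)) // ltn_exp2l.
  have z h : M h -> vanishes_from k.+1 h -> h i0 = 0.
    move=> Mh hv; case E : (h i0) => [[//|a]|a]; exfalso; apply: nohit; exists a; apply/asboolP.
      by exists h.
    exists (- h); split; [exact: latticeN| |by rewrite ffunE E].
    by move=> i ki; rewrite ffunE hv // oppr0.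
  by apply: codeP => //; apply: lower => //; apply: z.
have [m /asboolP[b [Mb bv bE]] mmin] := ex_minnP (ex_intro _ m0 hm0).
pose q f := (f i0 %/ m.+1%:Z)%Z.
have red f : M f -> vanishes_from k.+1 f -> M (f - b *~ q f) /\ vanishes_from k (f - b *~ q f).
  move=> Mf fv; have Mr : M (f - b *~ q f) by apply: MB => //; apply: latticeMz.
  have bz i : (b *~ q f) i = b i * q f by rewrite ffun_intmulE.
  have rv : vanishes_from k.+1 (f - b *~ q f).
    by move=> i ki; rewrite !ffunE bz fv // bv // mul0r subr0.
  split=> //; apply: lower => //.
  have rE : (f - b *~ q f) i0 = (f i0 %% m.+1%:Z)%Z.
    rewrite !ffunE bz bE /q {1}(divz_eq (f i0) m.+1%:Z); by ring.
  have r_ge0 := modz_ge0 (f i0) (isT : m.+1%:Z != 0).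
  have r_lt := ltz_pmod (f i0) (isT : 0 < m.+1%:Z).
  case E : (f i0 %% m.+1%:Z)%Z rE r_ge0 r_lt => [[//|a]|//] rE _; rewrite ltz_nat ltnS => am.
  have : hit a by apply/asboolP; exists (f - b *~ q f).
  by move=> /mmin; rewrite leqNgt am.
(* one more bit: the parity of the coefficient of b *)
exists (fun f => 2 * code (f - b *~ q f)%R + `|(q f %% 2)%Z|)%N; split=> [f|f g Mf Mg fv gv e].
  by have := code_lt (f - b *~ q f); rewrite expnS; clear; lia.
have [Mf' fv'] := red f Mf fv; have [Mg' gv'] := red g Mg gv.
have [h [Mh hE]] : double_congruent (f - b *~ q f) (g - b *~ q g) by apply: codeP => //; lia.
have [r rE] : exists r, q f - q g = r * 2 by exists ((q f - q g) %/ 2)%Z; lia.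
exists (h + b *~ r); split; first by apply: latticeD => //; apply: latticeMz.
rewrite mulrnDl -hE.
have -> : b *~ r *+ 2 = b *~ q f - b *~ q g by rewrite -mulrzBr rE mulrzA.
by rewrite [b *~ q f - _]addrC addrACA addrAC; apply/ffunP => i; rewrite !ffunE; ring.
Qed.

Lemma incongruent_size (l : seq {ffun 'I_n -> int}) : (forall f, f \in l -> M f) ->
  uniq l -> {in l &, forall f g, double_congruent f g -> f = g} -> (size l <= 2 ^ n)%N.
Proof.
move=> lM ul inc; have [code [code_lt codeP]] := lattice_code (leqnn n).
have uc : uniq (map code l).
  rewrite map_inj_in_uniq // => f g fl gl e; apply: inc => //.
  by apply: codeP => //; [exact: lM | exact: lM | |] => i; rewrite leqNgt ltn_ord.
rewrite -(size_map code) -(size_iota 0 (2 ^ n)); apply: uniq_leq_size => // _ /mapP[f _ ->].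
by rewrite mem_iota /= add0n.
Qed.

(** The last hypothesis holds when l is in a nontrivial coset of a sublattice that
    contains 2M and has index 2 in M.  Then l and its translate by the
    opposite of one of its members lie in disjoint sets of classes. *)
Lemma incongruent_coset_size (l : seq {ffun 'I_n -> int}) : (0 < n)%N ->
    (forall f, f \in l -> M f) -> uniq l ->
    {in l &, forall f g, double_congruent f g -> f = g} ->
    (forall f g h, f \in l -> g \in l -> h \in l -> ~ double_congruent f (g - h)) ->
  (size l <= 2 ^ (n - 1))%N.
Proof.
move=> n0 lM ul inc sgn; case: (posnP (size l)) => [->//|l0].
have [h hl] : exists h, h \in l by exists (nth 0 l 0); rewrite mem_nth.
(* translating by -h doubles the number of classes *)
have : (size (l ++ [seq (f - h)%R | f <- l]) <= 2 ^ n)%N.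
  apply: incongruent_size.
  - move=> f; rewrite mem_cat => /orP[/lM//|/mapP[g gl ->]].
    by apply: MB; apply: lM.
  - rewrite cat_uniq ul map_inj_uniq ?ul ?andbT; last exact: addIr.
    apply/hasPn => _ /mapP[g gl ->]; apply/negP => gh.
    by apply: (sgn _ _ _ gh gl hl); apply: double_congruent_refl.
  move=> f g; rewrite !mem_cat => /orP[fl|/mapP[f' fl ->]] /orP[gl|/mapP[g' gl ->]] cg.
  - exact: inc.
  - by case: (sgn _ _ _ fl gl hl cg).
  - by case: (sgn _ _ _ gl fl hl (double_congruent_sym cg)).
  congr (_ - h); apply: inc => //; case: cg => k [Mk kE]; exists k; split=> //.
  by rewrite -kE opprB addrA subrK.
have -> : (2 ^ n = 2 * 2 ^ (n - 1))%N by rewrite -expnS; congr (2 ^ _)%N; lia.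
by rewrite size_cat size_map addnn -mul2n leq_pmul2l.
Qed.
End Lattice.

(** * From exponent vectors to the bound *)

Local Open Scope classical_set_scope.
Local Open Scope card_scope.
Local Open Scope ring_scope.

(** Lists avoid having to know in advance that S is finite. *)
Lemma card_le_of_uniq_seq (T : eqType) (S : set T) K :
  (forall l : seq T, uniq l -> (forall t, t \in l -> S t) -> (size l <= K)%N) ->
  S #<= `I_K.
Proof.
move=> H.
have bound m : `I_m #<= S -> (m <= K)%N.
  move=> /pcard_geP[f].
  have /choice[g gP] (i : 'I_m) : exists t, S t /\ f t = i.
    by have [t St ft] := @surj _ _ _ _ f i (ltn_ord i); exists t.
  have := H [seq g i | i <- enum 'I_m]; rewrite size_map size_enum_ord; apply.
    rewrite map_inj_uniq ?enum_uniq // => i j e.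
    by apply: val_inj; rewrite -[LHS](gP i).2 e (gP j).2.
  by move=> _ /mapP[i _ ->]; case: (gP i).
have [finS|/infiniteP infS] := pselect (finite_set S); last first.
  by have := bound K.+1 (card_le_trans (card_leT _) infS); rewrite ltnn.
have [m Sm] := finS; rewrite (card_le_eql Sm) card_le_II; apply: bound.
by rewrite (card_le_eqr Sm) card_lexx.
Qed.

Section Exponents.
Variables (n : nat) (d : 'I_n -> nat).
Implicit Types x y a b g : {ffun 'I_n -> int}.

Definition natpow x : nat := \prod_(i < n) (d i ^ `|x i|)%N.
Definition nonneg x := forall i, 0 <= x i.

Lemma nonnegD x y : nonneg x -> nonneg y -> nonneg (x + y).
Proof. by move=> hx hy i; rewrite ffunE; apply: addr_ge0; [apply: hx | apply: hy]. Qed.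

Lemma natpowD x y : nonneg x -> nonneg y -> natpow (x + y) = (natpow x * natpow y)%N.
Proof.
move=> hx hy; rewrite /natpow -big_split /=; apply: eq_bigr => i _.
by rewrite -expnD ffunE -(gez0_abs (hx i)) -(gez0_abs (hy i)).
Qed.

Lemma natpow_gt0 x : (forall i, (0 < d i)%N) -> (0 < natpow x)%N.
Proof. by move=> d0; apply: prodn_gt0 => i; rewrite expn_gt0 d0. Qed.

Lemma coprime_natpow (c : nat) x : (forall i, coprime (d i) c) -> coprime (natpow x) c.
Proof.
by move=> dc; apply: (big_ind (fun m => coprime m c)) => [|u v|i _]; 
  rewrite ?coprime1n ?coprimeMl ?coprimeXl // => -> ->.
Qed.

Lemma prime_dvd_natpow p x : prime p -> 
  (p %| natpow x)%N = [exists i, (x i != 0) && (p %| d i)%N].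
Proof.
move=> pp; rewrite /natpow.
apply/idP/existsP => [|[i /andP[xi pi]]].
  have p1 : (p %| 1)%N = false by rewrite dvdn1; case: eqP pp => // ->.
  rewrite (big_morph (dvdn p) (fun u v => Euclid_dvdM u v pp) p1).
  rewrite big_orE => /existsP[i]; rewrite Euclid_dvdX // absz_gt0 => /= /andP[pd xi].
  by exists i; rewrite xi.
by rewrite (bigD1 i) //= dvdn_mulr // dvdn_exp // absz_gt0.
Qed.

End Exponents.

Section ExponentSolutions.
Variables (n c : nat) (d : 'I_n -> nat).
Hypotheses (c_gt1 : (1 < c)%N) (c_odd : odd c).
Hypotheses (d_gt1 : forall i, (1 < d i)%N) (d_coprime : forall i, coprime (d i) c).
Implicit Types x y a b g : {ffun 'I_n -> int}.

Definition divides_some (p : nat) := [exists i, (p %| d i)%N].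

Record exp_solution x y (z : nat) : Prop := ExpSolution {
  exp_ge0l : nonneg x;
  exp_ge0r : nonneg y;
  exp_support : forall i, (x i != 0) || (y i != 0);
  exp_lt : (natpow d x < natpow d y)%N;
  exp_sum : (natpow d x + natpow d y = c ^ z)%N }.

Let d_gt0 i : (0 < d i)%N. Proof. exact: ltnW. Qed.

Lemma solution_of_exp x y z : exp_solution x y z ->
  solution c divides_some (natpow d x) (natpow d y) z.
Proof.
case=> x0 y0 supp lt s; split=> //; first by rewrite natpow_gt0.
  exact: coprime_natpow.
move=> p pp; rewrite Euclid_dvdM // !prime_dvd_natpow //; apply/orP/existsP.
  by case=> /existsP[i /andP[_ pi]]; exists i.
by case=> i pi; case/orP: (supp i) => h; [left|right]; apply/existsP; exists i; rewrite h.
Qed.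

(** The lattice M of the vectors g with d^g = 1 or -1 modulo c.  Writing g as a
    difference of nonnegative vectors keeps to integers, without inverses
    modulo c. *)
Definition pm_lattice g := exists a b, [/\ nonneg a, nonneg b, g = a - b
  & (c%:Z %| (natpow d a)%:Z - (natpow d b)%:Z)%Z \/
    (c%:Z %| (natpow d a)%:Z + (natpow d b)%:Z)%Z].

Lemma pm_lattice0 : pm_lattice 0.
Proof. by exists 0, 0; split; rewrite ?subrr //; [move=> i; rewrite ffunE ..|left]. Qed.

Lemma pm_latticeB f g : pm_lattice f -> pm_lattice g -> pm_lattice (f - g).
Proof.
case=> a [b [a0 b0 -> ab]] [a' [b' [a0' b0' -> ab']]].
exists (a + b'), (b + a'); split; [exact: nonnegD | exact: nonnegD | |].
  by apply/ffunP => i; rewrite !ffunE; ring.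
rewrite !natpowD // !PoszM; move: ab ab'; move: (natpow d a)%:Z (natpow d b)%:Z.
move=> A B ab; move: (natpow d a')%:Z (natpow d b')%:Z => A' B' ab'.
case: ab => /dvdzP[q qE]; case: ab' => /dvdzP[r rE].
- left; rewrite (_ : _ - _ = (A - B) * B' - B * (A' - B')); last by ring.
  by rewrite qE rE; apply/dvdzP; exists (q * B' - B * r); ring.
- right; rewrite (_ : _ + _ = (A - B) * B' + B * (A' + B')); last by ring.
  by rewrite qE rE; apply/dvdzP; exists (q * B' + B * r); ring.
- right; rewrite (_ : _ + _ = (A + B) * B' + B * (A' - B')); last by ring.
  by rewrite qE rE; apply/dvdzP; exists (q * B' + B * r); ring.
left; rewrite (_ : _ - _ = (A + B) * B' - B * (A' + B')); last by ring.
by rewrite qE rE; apply/dvdzP; exists (q * B' - B * r); ring.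
Qed.

Lemma pm_lattice_exp x y z : exp_solution x y z -> pm_lattice (x - y).
Proof.
move=> S; have z0 := solution_exp_gt0 c_gt1 c_odd (solution_of_exp S).
case: S => x0 y0 _ _ s; exists x, y; split=> //; right.
by rewrite -PoszD s dvdzE dvdn_exp.
Qed.

(** The identity on X and Y holds because the exponents on both sides agree. *)
Lemma linked_of_double_congruent x y z x' y' z' :
    exp_solution x y z -> exp_solution x' y' z' ->
    double_congruent pm_lattice (x - y) (x' - y') ->
  linked c (natpow d x) (natpow d y) (natpow d x') (natpow d y').
Proof.
case=> x0 y0 _ _ _ [x0' y0' _ _ _] [h [[a [b [a0 b0 -> ab]]] e]].
exists (natpow d a), (natpow d b); split=> //; first by rewrite natpow_gt0.
  exact: coprime_natpow.
rewrite -!mulnn -!natpowD //; do ?exact: nonnegD.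
congr natpow; apply/ffunP => i; move/ffunP/(_ i): e.
by rewrite mulr2n !ffunE; move: (x i) (y i) (x' i) (y' i) (a i) (b i); lia.
Qed.

(** Modulo c, the left vector has d^f = -1 and the right one has d^f = 1, while
    d^f = 1 on 2M.  With denominators cleared this makes c divide 2 times a
    number coprime to c. *)
Lemma not_double_congruent_sub x1 y1 z1 x2 y2 z2 x3 y3 z3 :
    exp_solution x1 y1 z1 -> exp_solution x2 y2 z2 -> exp_solution x3 y3 z3 ->
  ~ double_congruent pm_lattice (x1 - y1) ((x2 - y2) - (x3 - y3)).
Proof.
move=> S1 S2 S3.
have dvd x y z : exp_solution x y z -> (c%:Z %| (natpow d x)%:Z + (natpow d y)%:Z)%Z.
  move=> S; have z0 := solution_exp_gt0 c_gt1 c_odd (solution_of_exp S).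
  by case: S => _ _ _ _ s; rewrite -PoszD s dvdzE dvdn_exp.
have D1 := dvd _ _ _ S1; have D2 := dvd _ _ _ S2; have D3 := dvd _ _ _ S3.
case: S1 S2 S3 => x10 y10 _ _ _ [x20 y20 _ _ _] [x30 y30 _ _ _].
case=> h [[a [b [a0 b0 -> ab]]] e].
have E : (natpow d x1 * natpow d y2 * natpow d x3 * (natpow d b * natpow d b) =
    natpow d y1 * natpow d x2 * natpow d y3 * (natpow d a * natpow d a))%N.
  rewrite -!natpowD //; do ?by do ?apply: nonnegD.
  congr natpow; apply/ffunP => i; move/ffunP/(_ i): e.
  rewrite mulr2n !ffunE; move: (x1 i) (y1 i) (x2 i) (y2 i) (x3 i) (y3 i) (a i) (b i); lia.
have cop x : coprimez c (natpow d x).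
  by rewrite coprimezE coprime_sym coprime_natpow.
have {}E : (natpow d x1)%:Z * (natpow d y2)%:Z * (natpow d x3)%:Z * (natpow d b)%:Z ^+ 2 =
    (natpow d y1)%:Z * (natpow d x2)%:Z * (natpow d y3)%:Z * (natpow d a)%:Z ^+ 2.
  by rewrite !expr2 -!PoszM E.
have A2 : (c%:Z %| (natpow d a)%:Z ^+ 2 - (natpow d b)%:Z ^+ 2)%Z.
  by rewrite subr_sqr; case: ab => ab; [apply: dvdz_mulr | apply: dvdz_mull].
have : (c%:Z %| (natpow d y1)%:Z * (natpow d y2)%:Z * (natpow d y3)%:Z *
    (2 * (natpow d b)%:Z ^+ 2))%Z.
  move: E A2 D1 D2 D3; move: (natpow d a)%:Z (natpow d b)%:Z => A B.
  move: (natpow d x1)%:Z (natpow d x2)%:Z (natpow d x3)%:Z => X1 X2 X3.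
  move: (natpow d y1)%:Z (natpow d y2)%:Z (natpow d y3)%:Z => Y1 Y2 Y3 E A2 D1 D2 D3.
  (* replace each X by -Y and A^2 by B^2 in E *)
  have -> : Y1 * Y2 * Y3 * (2 * B ^+ 2) =
     Y1 * Y3 * A ^+ 2 * (X2 + Y2) - Y2 * X3 * B ^+ 2 * (X1 + Y1)
     + Y1 * Y2 * B ^+ 2 * (X3 + Y3) - Y1 * Y2 * Y3 * (A ^+ 2 - B ^+ 2)
     + (X1 * Y2 * X3 * B ^+ 2 - Y1 * X2 * Y3 * A ^+ 2) by ring.
  rewrite E subrr addr0; apply: rpredB; last exact: dvdz_mull.
  by apply: rpredD; [apply: rpredB|]; apply: dvdz_mull.
have c2 : coprimez c 2 by rewrite coprimez_sym coprimezE prime_coprime // dvdn2 c_odd.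
rewrite -[X in (_ %| X)%Z]mulr1 Gauss_dvdzr; first by rewrite dvdz1 /=; lia.
by rewrite !coprimezMr c2 !cop.
Qed.

Definition solution_values (t : {ffun 'I_n -> int} * {ffun 'I_n -> int} * nat) :=
  (natpow d t.1.1, natpow d t.1.2, t.2).

(** At most one member of the list is the larger one of an exceptional pair; the
    others are pairwise incongruent modulo 2M. *)
Lemma exp_solutions_size (l : seq ({ffun 'I_n -> int} * {ffun 'I_n -> int} * nat)) :
    (0 < n)%N -> (forall t, t \in l -> exp_solution t.1.1 t.1.2 t.2) ->
    uniq l -> {in l &, injective solution_values} ->
  (size l <= 2 ^ (n - 1) + 1)%N.
Proof.
move=> n0 lS ul tinj.
pose istop t :=
  `[< is_top c divides_some (solution_values t).1.1 (solution_values t).1.2 (solution_values t).2 >].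
pose diff (t : {ffun 'I_n -> int} * {ffun 'I_n -> int} * nat) := t.1.1 - t.1.2.
have nottop t : t \in seq.filter (predC istop) l -> t \in l /\ ~ istop t.
  by rewrite mem_filter => /andP[/negP].
have inj t s : t \in seq.filter (predC istop) l -> s \in seq.filter (predC istop) l ->
    double_congruent pm_lattice (diff t) (diff s) -> t = s.
  move=> /nottop[tl tt] /nottop[sl st] cts; have St := lS t tl; have Ss := lS s sl.
  have cst := double_congruent_sym pm_lattice0 pm_latticeB cts.
  have L := linked_of_double_congruent St Ss cts.
  have L' := linked_of_double_congruent Ss St cst.
  have := linked_eq_or_top c_gt1 c_odd (solution_of_exp St) (solution_of_exp Ss) L L'.
  case=> [[XX YY zz]|ht|hs].
  - by apply: tinj => //; rewrite /solution_values XX YY zz.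
  - by case: tt; apply/asboolP.
  - by case: st; apply/asboolP.
have dinj : {in seq.filter (predC istop) l &, injective diff}.
  by move=> t s tl sl e; apply: inj => //; rewrite e; apply: (double_congruent_refl pm_lattice0).
have top1 : (size (seq.filter istop l) <= 1)%N.
  have ut : uniq (seq.filter istop l) by rewrite filter_uniq.
  have : {in seq.filter istop l &, forall t s, t = s}.
    move=> t s; rewrite !mem_filter => /andP[/asboolP tt tl] /andP[/asboolP ts sl].
    have [XX YY zz] := top_unique c_gt1 c_odd tt ts.
    by apply: tinj => //; move: XX YY zz; rewrite /solution_values /= => -> -> ->.
  case: (seq.filter istop l) ut => [|t [|s r]] //= /andP[+ _] h.
  by rewrite (h t s) ?inE ?eqxx ?orbT.
rewrite -(count_predC istop) -!size_filter addnC leq_add //.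
rewrite -(size_map diff).
apply: (incongruent_coset_size pm_lattice0 pm_latticeB n0).
- by move=> _ /mapP[t /nottop[tl _] ->]; apply: pm_lattice_exp (lS t tl).
- by rewrite map_inj_in_uniq // filter_uniq.
- by move=> _ _ /mapP[t tl ->] /mapP[s sl ->] /(inj t s tl sl) ->.
move=> _ _ _ /mapP[t /nottop[tl _] ->] /mapP[s /nottop[sl _] ->] /mapP[u /nottop[ul' _] ->].
exact: not_double_congruent_sub (lS t tl) (lS s sl) (lS u ul').
Qed.

End ExponentSolutions.

Lemma prod_pow_natpow n (d : 'I_n -> int) (x : {ffun 'I_n -> int}) :
  (forall i, 0 <= d i) -> nonneg x ->
  prod_pow d x = (natpow (fun i => `|d i|%N) x)%:R.
Proof.
move=> d0 x0; rewrite /prod_pow /natpow natr_prod; apply: eq_bigr => i _.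
by rewrite natrX -{1}(gez0_abs (d0 i)) -{1}(gez0_abs (x0 i)).
Qed.

Lemma exp_solution_of_solve n (c : int) (d : 'I_n -> int) x y z :
    1 < c -> (forall i, 1 < d i) -> exponents_solve c d x y z ->
  0 <= z /\ exp_solution `|c|%N (fun i => `|d i|%N) x y `|z|%N.
Proof.
move=> c1 d1 [s mx mn lt].
have xy0 i : 0 <= x i /\ 0 <= y i by move: (mn i); case: leP; lia.
have x0 : nonneg x by move=> i; case: (xy0 i).
have y0 : nonneg y by move=> i; case: (xy0 i).
have d0 i : 0 <= d i by apply: ltW; apply: lt_trans (d1 i).
have dn0 i : (0 < `|d i|)%N by have := d1 i; lia.
have cE : c%:~R = (`|c|%N)%:R :> rat by rewrite -{1}(gez0_abs (ltW (lt_trans ltr01 c1))).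
rewrite !prod_pow_natpow // cE -natrD in s.
rewrite !prod_pow_natpow // ltr_nat in lt.
have c1n : (1 < `|c|)%N by lia.
have big : (1 < natpow (fun i => `|d i|%N) x + natpow (fun i => `|d i|%N) y)%N.
  by have := natpow_gt0 x dn0; have := natpow_gt0 y dn0; lia.
case: z s => [k|k] s; last first.
  exfalso; move: big; rewrite ltnNge -(ler_nat rat) s NegzE -exprnN /=.
  by rewrite invf_le1 ?exprn_gt0 ?exprn_ege1 // ?ler1n ?ltr0n; lia.
split=> //; split=> //.
  by move=> i; move: (mx i) (mn i); case: leP; lia.
by apply/eqP; rewrite -(eqr_nat rat) s natrX.
Qed.

(** The logarithm of the product is the corresponding combination of the logarithms. *)
Lemma prod_pow_eq_exponents (R : realType) n (d : 'I_n -> int) (x x' : {ffun 'I_n -> int}) :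
    (forall i, 1 < d i) -> linear_independent_over_int (fun i => ln ((d i)%:~R : R)) ->
    nonneg x -> nonneg x' -> prod_pow d x = prod_pow d x' -> x = x'.
Proof.
move=> d1 indep x0 x0'.
have d0 i : 0 <= d i by apply: ltW; apply: lt_trans (d1 i).
have dR i : 0 < ((d i)%:~R : R) by rewrite ltr0z; apply: lt_trans (d1 i).
have lnE u : nonneg u ->
    (natpow (fun i => `|d i|%N) u)%:R = expR (\sum_i (u i)%:~R * ln ((d i)%:~R : R)).
  move=> u0; rewrite expR_sum /natpow natr_prod; apply: eq_bigr => i _.
  rewrite -{2}(gez0_abs (u0 i)) expRM_natl lnK ?posrE //.
  by rewrite natrX -{2}(gez0_abs (d0 i)).
rewrite !prod_pow_natpow // => /eqP; rewrite eqr_nat => /eqP e.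
have := lnE x x0; rewrite e lnE // => /expR_inj s.
apply/ffunP => i; apply/eqP; rewrite -subr_eq0; apply/eqP.
apply: (indep (fun i => x i - x' i)).
under eq_bigr => j _ do rewrite rmorphB mulrBl.
by rewrite sumrB s subrr.
Qed.

Theorem theorem1 (R : realType) (n : nat) (c : int) (d : 'I_n -> int)
    (n_ge1 : (1 <= n)%N) (c_gt1 : 1 < c) (d_gt1 : forall i, 1 < d i)
    (c_odd : ~~ (2 %| c)%Z) (d_coprime_c : forall i, coprimez (d i) c) :
  XYz_solutions c d #<= `I_(2 ^ (n - 1) + 1)%N /\
  (linear_independent_over_int (fun i => ln ((d i)%:~R : R)) ->
   xyz_solutions c d #<= `I_(2 ^ (n - 1) + 1)%N).
Proof.
have bound (l : seq (rat * rat * int)) : uniq l ->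
    (forall t, t \in l -> XYz_solutions c d t) -> (size l <= 2 ^ (n - 1) + 1)%N.
  move=> ul lS.
  have /choice[e eP] t : exists s : {ffun 'I_n -> int} * {ffun 'I_n -> int} * nat,
      t \in l -> [/\ exp_solution `|c|%N (fun i => `|d i|%N) s.1.1 s.1.2 s.2,
        t.1.1 = (natpow (fun i => `|d i|%N) s.1.1)%:R,
        t.1.2 = (natpow (fun i => `|d i|%N) s.1.2)%:R & t.2 = s.2].
    have [tl|_] := boolP (t \in l); last by exists (0, 0, 0%N).
    have [x [y [X Y S]]] := lS t tl; exists (x, y, `|t.2|%N) => _.
    have [z0 E] := exp_solution_of_solve c_gt1 d_gt1 S.
    have d0 i : 0 <= d i by apply: ltW; apply: lt_trans (d_gt1 i).
    have [x0 y0 _ _ _] := E.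
    by split=> //=; rewrite ?X ?Y ?prod_pow_natpow ?gez0_abs.
  have einj : {in l &, forall t s,
      solution_values (fun i => `|d i|%N) (e t) =
        solution_values (fun i => `|d i|%N) (e s) -> t = s}.
    move=> [[X Y] z] [[X' Y'] z'] tl sl [a b k].
    have [_ /= hX hY hz] := eP _ tl; have [_ /= hX' hY' hz'] := eP _ sl.
    have XX : X = X' := etrans hX (etrans (congr1 (GRing.natmul 1) a) (esym hX')).
    have YY : Y = Y' := etrans hY (etrans (congr1 (GRing.natmul 1) b) (esym hY')).
    by rewrite XX YY (etrans hz (etrans (congr1 Posz k) (esym hz'))).
  rewrite -(size_map e); apply: (@exp_solutions_size n `|c|%N (fun i => `|d i|%N)) => //.
  - by lia.
  - by move: c_odd; rewrite dvdzE; lia.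
  - by move=> i; have := d_gt1 i; lia.
  - by move=> _ /mapP[t tl ->]; case: (eP t tl).
  - by rewrite map_inj_in_uniq // => t s tl sl E; apply: einj => //; rewrite E.
  by move=> _ _ /mapP[t tl ->] /mapP[s sl ->] E; congr e; apply: einj.
split=> [|indep]; first exact: card_le_of_uniq_seq.
apply: card_le_of_uniq_seq => l ul lS.
pose F (t : {ffun 'I_n -> int} * {ffun 'I_n -> int} * int) :=
  (prod_pow d t.1.1, prod_pow d t.1.2, t.2).
rewrite -(size_map F); apply: bound.
  rewrite map_inj_in_uniq // => -[[x y] z] [[x' y'] z'] tl sl [X Y zz].
  have [_ [x0 y0 _ _ _]] := exp_solution_of_solve c_gt1 d_gt1 (lS _ tl).
  have [_ [x0' y0' _ _ _]] := exp_solution_of_solve c_gt1 d_gt1 (lS _ sl).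
  by congr (_, _, _) => //; apply: (prod_pow_eq_exponents d_gt1 indep).
by move=> _ /mapP[[[x y] z] tl ->]; exists x, y; split=> //; apply: lS tl.
Qed.
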